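(* Let $Y=(Y_1,\dots,Y_d)$ have independent, symmetric, nonzero coordinates such that each $N_i(u)=-\log\mathbb P(|Y_i|\ge u)$, $u\ge0$, is closed, convex and nondecreasing with $N_i(0)=0$ (value $+\infty$ allowed), normalized so that $q_i(1)=1$, where $q_i(p)=\sup\{u\ge0:N_i(u)\le p\}$. Let $\Psi_i$, $\Phi_i$ and $E_0$ be the intrinsic cost, the expansion cost and the error cost defined in the context. Then for all $i$ and all $r\ge0$, $$\Psi_i(r)\le 2\Phi_i(r)+2E_0(r),\qquad \Phi_i(r/2)\le\Psi_i(r)+E_0(r/2),\qquad \int_0^\infty E_0(r)\,r^{-2}\,dr=2.$$ Moreover there is a universal constant $C\ge1$ such that $C^{-1}\mathcal R_\Phi(\mu)\le\mathcal R_\Psi(\mu)\le C\,\mathcal R_\Phi(\mu)$ for every finitely supported probability law $\mu$ on $\mathbb R^d$.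
   Context: Intrinsic costs. Let $b_i=\lim_{p\to\infty}q_i(p)\in[1,\infty]$. If $b_i>1$ define $V_i(u)=u^2$ for $|u|\le 1$, $V_i(u)=2N_i(|u|)-1$ for $1<|u|\le b_i$, and $V_i(u)=+\infty$ for $|u|>b_i$. If $b_i=1$ define $V_i(u)=u^2$ on $[-1,1]$ and $+\infty$ outside. For $0<s<b_i$ let $\sigma_i(s)=V'_{i,+}(s)$ (right derivative) and $\Psi_i(r)=\int_0^{b_i}\sigma_i(s)\mathbf 1_{\{\sigma_i(s)<r\}}\,ds$, $r\ge 0$. Expansion and error costs. Let $\chi(r)=\min(1,r^2)$. For $1\le\beta\le\infty$ let $\psi_\beta(r)=r^2/4$ for $0\le r\le2$ and $\psi_\beta(r)=2\beta-1$ for $r>2$ (equal to $+\infty$ if $\beta=\infty$). For integers $j\ge0$ put $s_j=2^{j+1}$, $a_j=2/s_j=2^{-j}$, $$A_{ij}=\{u\in[1,b_i): s_j\le\sigma_i(u)<2s_j\},\qquad w_{ij}=s_j|A_{ij}|\in[0,\infty],$$ where $|\cdot|$ is Lebesgue measure, and for those $j$ with $w_{ij}\ge1$ put $\beta_{ij}=(w_{ij}+1)/2\in[1,\infty]$. Define $$\Phi_i(r)=\chi(r/2)+\sum_{j:\,w_{ij}\ge1}\psi_{\beta_{ij}}(a_jr),\qquad E_0(r)=\sum_{j\ge0}\chi(r/s_j),\qquad r\ge 0.$$ Rate-distortion functional. For nondecreasing $d_i:[0,\infty)\to[0,\infty]$ with $d_i(0)=0$, $D^d_t(x,y)=\sum_i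 d_i(|x_i-y_i|/t)$; $\mathrm{RD}^d_\mu(t)=\inf\{I(X;X')+\mathbb E D^d_t(X,X')\}$ over all couplings $(X,X')$ with both marginals $\mu$ ($I$ is mutual information, natural logarithm, $0\cdot\infty=0$); $\mathcal R_d(\mu)=\int_0^\infty\mathrm{RD}^d_\mu(t)\,dt$. $\mathcal R_\Psi,\mathcal R_\Phi$ use $d_i=\Psi_i$, $d_i=\Phi_i$ respectively. *)

(* Defs.v *)
From HB Require Import structures.
From mathcomp Require Import all_boot all_order all_algebra.
From mathcomp Require Import all_classical all_reals all_analysis.

Set Implicit Arguments.
Unset Strict Implicit.
Unset Printing Implicit Defensive.

Import Order.TTheory GRing.Theory Num.Theory.
Import numFieldNormedType.Exports.

Local Open Scope classical_set_scope.
Local Open Scope charge_scope.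
Local Open Scope ring_scope.

Section random_vector.
Context (disp : measure_display) (Omega : measurableType disp) (R : realType).
Variable P : probability Omega R.

(* For a family indexed by a finite type, the product rule over the whole
   family gives it for every subfamily: take A i = setT outside. *)
Definition mutually_independent (n : nat) (Y : 'I_n -> {RV P >-> R}) : Prop :=
  forall A : 'I_n -> set R, (forall i, measurable (A i)) ->
    P (\bigcap_(i in [set: 'I_n]) (Y i @^-1` A i)) =
    (\prod_(i < n) P (Y i @^-1` A i))%E.

Definition symmetric_rv (X : {RV P >-> R}) : Prop :=
  forall A : set R, measurable A ->
    P [set w | A (X w)] = P [set w | A (- X w)].

Definition nonzero_rv (X : {RV P >-> R}) : Prop :=
  (P [set w | X w = 0%R] < 1)%E.

(* [lne 0 = -oo], so the value is [+oo] where the tail vanishes. *)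
Definition log_tail (X : {RV P >-> R}) (u : R) : \bar R :=
  (- lne (P [set w | (u <= `|X w|)%R]))%E.

End random_vector.

Section costs.
Context (R : realType).
Implicit Types (N : R -> \bar R) (r s u : R) (j : nat).

(* [log_tail X] vanishes on the negative reals, so lower semicontinuity on the
   whole line is the same as on [0, +oo[. *)
Definition closed_convex_tail N : Prop :=
  [/\ lower_semicontinuous N,
      forall u v t : R, 0 <= u -> 0 <= v -> 0 <= t <= 1 ->
        (N (t * u + (1 - t) * v)%R <= t%:E * N u + (1 - t)%:E * N v)%E,
      forall u v, 0 <= u -> u <= v -> (N u <= N v)%E &
      N 0 = 0%E].

Definition tail_inverse N (p : R) : \bar R :=
  ereal_sup [set u%:E | u in [set u | 0 <= u /\ (N u <= p%:E)%E]].

Definition tail_bound N : \bar R :=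
  lim (tail_inverse N p @[p --> +oo%R]).

Definition intrinsic_potential N u : \bar R :=
  let b := tail_bound N in
  if (1 < b)%E then
    if `|u| <= 1 then (u ^+ 2)%:E
    else if (`|u|%R%:E <= b)%E then (2%:E * N `|u|%R - 1)%E
    else +oo%E
  else
    if `|u| <= 1 then (u ^+ 2)%:E else +oo%E.

(* Only used for 0 < s < tail_bound N, where the potential is finite near s. *)
Definition intrinsic_slope N s : R :=
  lim ((fine (intrinsic_potential N (s + h)) - fine (intrinsic_potential N s))
         / h @[h --> (0 : R)^'+]).

Definition intrinsic_cost N r : \bar R :=
  \int[lebesgue_measure]_(s in [set s | 0 < s /\ (s%:E < tail_bound N)%E])
    (intrinsic_slope N s * \1_[set s | intrinsic_slope N s < r] s)%:E.

Definition chi r : R := Num.min 1 (r ^+ 2).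

Definition psi (beta : \bar R) r : \bar R :=
  if r <= 2 then (r ^+ 2 / 4)%:E else (2%:E * beta - 1)%E.

Definition dyadic_slope j : R := 2 ^+ j.+1.

Definition dyadic_step j : R := 2 / dyadic_slope j.

Definition slope_level N j : set R :=
  [set u | [/\ 1 <= u, (u%:E < tail_bound N)%E,
              dyadic_slope j <= intrinsic_slope N u &
              intrinsic_slope N u < 2 * dyadic_slope j]].

Definition level_weight N j : \bar R :=
  ((dyadic_slope j)%:E * lebesgue_measure (slope_level N j))%E.

Definition level_beta N j : \bar R :=
  ((level_weight N j + 1) * (2^-1)%:E)%E.

Definition expansion_cost N r : \bar R :=
  ((chi (r / 2)%R)%:E +
   \sum_(0 <= j <oo | 1 <= level_weight N j)
     psi (level_beta N j) (dyadic_step j * r)%R)%E.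

Definition error_cost r : \bar R :=
  (\sum_(0 <= j <oo) (chi (r / dyadic_slope j)%R)%:E)%E.

End costs.

(* In nats. *)
Definition relative_entropy (disp : measure_display) (T : measurableType disp)
    (R : realType) (mu : {finite_measure set T -> \bar R})
    (nu : {sigma_finite_measure set T -> \bar R}) : \bar R :=
  if `[< mu `<< nu >] then
    (\int[mu]_x lne (('d (charge_of_finite_measure mu) '/d nu) x))%E
  else +oo%E.

Section mutual_information.
Context (d1 d2 : measure_display) (T1 : measurableType d1)
  (T2 : measurableType d2) (R : realType).

HB.instance Definition _ := isMeasurableFun.Build _ _ (T1 * T2)%type T1
  (@fst T1 T2) measurable_fst.

HB.instance Definition _ := isMeasurableFun.Build _ _ (T1 * T2)%type T2
  (@snd T1 T2) measurable_snd.

Definition product_law (mu : probability T1 R) (nu : probability T2 R) :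
    probability (T1 * T2)%type R :=
  (mu \x nu)%E.

Definition mutual_information (joint : probability (T1 * T2)%type R) :
    \bar R :=
  relative_entropy joint
    (product_law (distribution joint fst) (distribution joint snd)).

Definition coupling (mu : probability T1 R) (nu : probability T2 R)
    (joint : probability (T1 * T2)%type R) : Prop :=
  (forall A, measurable A -> distribution joint fst A = mu A) /\
  (forall B, measurable B -> distribution joint snd B = nu B).

End mutual_information.

Section rate_distortion.
Context (R : realType) (n : nat).
Implicit Types (d : 'I_n -> R -> \bar R) (mu : probability (n.-tuple R) R).

Definition distortion d (t : R) (x y : n.-tuple R) : \bar R :=
  (\sum_(i < n) d i (`|tnth x i - tnth y i| / t)%R)%E.

Definition rate_distortion d mu (t : R) : \bar R :=
  ereal_inf [set (mutual_information joint +
                  \int[joint]_z distortion d t z.1 z.2)%E |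
             joint in [set joint | coupling mu mu joint]].

Definition rate_distortion_integral d mu : \bar R :=
  (\int[lebesgue_measure]_(t in `]0%R, +oo[) rate_distortion d mu t)%E.

Definition finitely_supported mu : Prop :=
  exists2 S : set (n.-tuple R), finite_set S & mu S = 1%E.

End rate_distortion.

(* Main.v *)
Require Import Defs.
From HB Require Import structures.
From mathcomp Require Import all_boot all_order all_algebra.
From mathcomp Require Import all_classical all_reals all_analysis.
From mathcomp Require Import measurable_realfun ring lra.

(* The costs. The slope sigma of the intrinsic potential is 2s on ]0, 1[, and
   nondecreasing with values >= 2 on [1, b[, so the levels A_j partition [1, b[
   and Psi r = chi (r / 2) + sum_j \int_(A_j) sigma 1{sigma < r}. The j-th term
   vanishes for r <= s_j, is at most 2 w_j, and is at least w_j for r >= 2 s_j;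
   this is compared with psi (a_j r) if w_j >= 1, with chi (r / s_j) otherwise.

   The functionals. Both costs satisfy d r <= 2 e (2r) + 2 E_0 r for the other
   cost e, and e r >= chi (r / 2), so
     d r <= 4 sum_(j < J) e (2r / 2^j) + 2 r^2 / 2^J.
   Take couplings (X, X_j), j < J, that are nearly optimal for e at the scales
   2^j t / 4, make the X_j conditionally independent given X, and draw X' from
   the posterior law of X given all of them. Then I(X; X') <= sum_j I(X; X_j),
   and since (X_j, X') has the law of (X_j, X), the triangle inequality through
   X_j bounds the j-th cost of (X, X'). As J grows,
     RD^d(t) <= 8 sum_j RD^e(2^j t / 4),
   and integrating over t gives R_d <= 8 * 4 * 2 * R_e. *)

Set Implicit Arguments.
Unset Strict Implicit.
Unset Printing Implicit Defensive.

Import Order.TTheory GRing.Theory Num.Theory.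
Import numFieldNormedType.Exports.

Local Open Scope classical_set_scope.
Local Open Scope ring_scope.

(** * Couplings on a finite alphabet and the posterior coupling *)

Section finite_couplings.
Context (R : realType) (I : finType).
Implicit Types (m : I -> R) (p : I -> I -> R).

Definition finite_coupling m p : Prop :=
  [/\ forall k l, 0 <= p k l, forall k, \sum_l p k l = m k &
      forall l, \sum_k p k l = m l].

Definition finite_information m p : R :=
  \sum_k \sum_l p k l * ln (p k l / (m k * m l)).

(** This is ln z <= z - 1 at z = b / a, multiplied by a. The implication between the signs plays the
    role of absolute continuity: for a > 0 and b = 0 the conventions a / 0 = 0 and ln 0 = 0 would
    make the bound false. *)
Lemma subr_le_mul_ln (a b : R) : 0 <= a -> 0 <= b -> (0 < a -> 0 < b) ->
  a - b <= a * ln (a / b).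
Proof.
rewrite le_eqVlt => /predU1P[<-|a0] b0 ab; first by rewrite mul0r sub0r oppr_le0.
have {}b0 := ab a0.
have := @le_ln1Dx R (b / a - 1).
rewrite ltrBrDr addNr divr_gt0// => /(_ isT); rewrite addrC subrK.
rewrite -[X in ln X]invf_div lnV ?posrE ?divr_gt0// => h.
have : a * (- ln (a / b)) <= a * (b / a - 1) by rewrite ler_pM2l.
rewrite mulrBr mulr1 mulrCA divff ?gt_eqF// mulr1 mulrN.
by rewrite lerNl opprB.
Qed.

Lemma ln_prod (J : finType) (f : J -> R) : (forall j, 0 < f j) ->
  ln (\prod_j f j) = \sum_j ln (f j).
Proof.
move=> f0.
(* Positivity of the partial products is carried through the induction, because [lnM] asks for
   it. *)
suff [] : 0 < \prod_j f j /\ ln (\prod_j f j) = \sum_j ln (f j) by [].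
apply: (big_ind2 (fun x y => 0 < x /\ ln x = y)) => [|x _ y _ [x0 <-] [y0 <-]|//].
  by rewrite ln1.
by rewrite mulr_gt0// lnM.
Qed.

Lemma finite_coupling_le m p k l : finite_coupling m p ->
  p k l <= m k /\ p k l <= m l.
Proof.
case=> p0 pl pr; rewrite -(pl k) -(pr l); split.
- by rewrite (bigD1 l)//= lerDl sumr_ge0.
- by rewrite (bigD1 k)//= lerDl sumr_ge0.
Qed.

(** Gibbs' inequality: the termwise lower bounds p - m m' add up to 1 - 1 = 0. *)
Lemma finite_information_ge0 m p : \sum_k m k = 1 -> finite_coupling m p ->
  0 <= finite_information m p.
Proof.
move=> m1 cp; have [p0 pl pr] := cp.
have m0 k : 0 <= m k by rewrite -pl sumr_ge0.
suff : \sum_k \sum_l (p k l - m k * m l) <= finite_information m p.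
  apply: le_trans.
  under eq_bigr => k _ do rewrite sumrB pl -mulr_sumr m1 mulr1 subrr.
  by rewrite big1.
apply: ler_sum => k _; apply: ler_sum => l _.
apply: subr_le_mul_ln => // [|pkl0]; first exact: mulr_ge0.
by have [h1 h2] := finite_coupling_le k l cp; rewrite mulr_gt0 ?(lt_le_trans pkl0).
Qed.

Section mixture.
Context (m : I -> R) (J : finType) (c : J -> I -> I -> R).
Hypotheses (m_gt0 : forall k, 0 < m k) (m_sum : \sum_k m k = 1).
Hypothesis c_coupling : forall j, finite_coupling m (c j).

(* The law of (X, U), where U = (X_j)_j has conditionally independent
   coordinates given X, with (X, X_j) of law c j. *)
Let P k (u : {ffun J -> I}) : R := m k * \prod_j (c j k (u j) / m k).
Let Pu u : R := \sum_k P k u.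
(** [Q] is the law U would have if its coordinates were independent, whereas [Pu] is its actual law.
    [W] is the law of the triple (X, U, X'); a value u with [Pu u] = 0 gets mass 0 since division by
    zero gives 0. *)
Let Q (u : {ffun J -> I}) : R := \prod_j m (u j).
Let W k u l : R := P k u * P l u / Pu u.

(* X' is drawn from the posterior law of X given U. *)
Definition posterior_coupling k l : R := \sum_u W k u l.
Local Notation p := posterior_coupling.

Let c0 j k l : 0 <= c j k l. Proof. by case: (c_coupling j). Qed.

Let P0 k u : 0 <= P k u.
Proof.
apply: mulr_ge0; first exact: ltW.
by apply: prodr_ge0 => j _; apply: divr_ge0 => //; exact: ltW.
Qed.

Let Pu0 u : 0 <= Pu u. Proof. exact: sumr_ge0. Qed.

Let W0 k u l : 0 <= W k u l.
Proof. by rewrite /W divr_ge0// mulr_ge0. Qed.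

Let P_le_Pu k u : P k u <= Pu u.
Proof. by rewrite /Pu (bigD1 k)//= lerDl sumr_ge0. Qed.

Let Psum k : \sum_u P k u = m k.
Proof.
rewrite -mulr_sumr -(bigA_distr_bigA (fun j l => c j k l / m k)).
rewrite big1 ?mulr1// => j _; rewrite -mulr_suml.
by have [_ -> _] := c_coupling j; rewrite divff ?gt_eqF.
Qed.

Let Pmarg j k l : \sum_(u : {ffun J -> I} | u j == l) P k u = c j k l.
Proof.
rewrite -mulr_sumr.
(* The constraint on [u j] becomes an indicator inside the j-th factor, so that the sum over all
   functions u distributes over the product. The factors other than the j-th then sum to 1. *)
transitivity (m k * \sum_(u : {ffun J -> I}) \prod_i
    ((c i k (u i) / m k) * (if i == j then (u i == l)%:R else 1) : R)).
  congr (_ * _); rewrite big_mkcond/=; apply: eq_bigr => u _.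
  rewrite [RHS]big_split/= [X in _ = _ * X](bigD1 j)//=.
  rewrite eqxx [X in _ = _ * (_ * X)]big1 ?mulr1 => [|i /negPf ->//].
  by case: eqP; rewrite ?mulr1// mulr0.
rewrite -(bigA_distr_bigA (fun i l' => c i k l' / m k *
   (if i == j then (l' == l)%:R else 1))).
rewrite (bigD1 j)//= eqxx (bigD1 l)//= eqxx mulr1 big1 ?addr0; last first.
  by move=> l' /negPf ->; rewrite mulr0.
rewrite big1 ?mulr1 => [|i /negPf ->].
  by rewrite mulrC divfK ?gt_eqF.
under eq_bigr do rewrite mulr1.
by rewrite -mulr_suml; have [_ -> _] := c_coupling i; rewrite divff ?gt_eqF.
Qed.


Let Pu_eq0 u : Pu u <= 0 -> forall k, P k u = 0.
Proof. by move=> h k; apply/le_anti; rewrite P0 (le_trans _ h). Qed.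

Let Wsuml k u : \sum_l W k u l = P k u.
Proof.
rewrite /W -mulr_suml -mulr_sumr -/(Pu u).
(* If [Pu u] = 0, then every [P k u] vanishes as well and both sides are 0. *)
have [h|/Pu_eq0 h] := ltP 0 (Pu u); first by rewrite mulfK ?gt_eqF.
by rewrite h !mul0r.
Qed.

(** X and X' are exchangeable given U. This yields the second marginal of the posterior coupling,
    and gives (X', U) the law of (X, U) in the cost estimate. *)
Let WC k u l : W k u l = W l u k.
Proof. by rewrite /W (mulrC (P k u)). Qed.

Lemma posterior_couplingP : finite_coupling m p.
Proof.
have pC k l : p k l = p l k by apply: eq_bigr => u _; exact: WC.
have pl k : \sum_l p k l = m k.
  by rewrite exchange_big/=; under eq_bigr do rewrite Wsuml; exact: Psum.
split => [k l||l] //; first exact: sumr_ge0.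
by rewrite -[RHS]pl; apply: eq_bigr.
Qed.

(** Conditional independence given X makes the density of (X, U) relative to m x Q the product of
    the densities of the pairs (X, X_j). The factor [P k u] disposes of the points where the
    logarithm of the product does not split. *)
Let lnB k u : P k u * \sum_j ln (c j k (u j) / (m k * m (u j))) =
  P k u * ln (P k u / (m k * Q u)).
Proof.
have [->|Pn0] := eqVneq (P k u) 0; first by rewrite !mul0r.
congr (_ * _).
have cj j : 0 < c j k (u j).
  rewrite lt_neqAle c0 andbT eq_sym; apply: contra Pn0 => /eqP cj0.
  by rewrite /P (bigD1 j)//= cj0 !mul0r mulr0.
rewrite -ln_prod => [|j]; last by rewrite divr_gt0// mulr_gt0.
congr ln; rewrite /P -mulf_div divff ?gt_eqF// mul1r /Q -prodf_div.
by apply: eq_bigr => j _; rewrite invfM mulrA.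
Qed.

(** The right-hand side is the relative entropy of (X, U) with respect to m x Q; marginalizing on
    each pair (X, X_j) recovers the individual informations. *)
Let info_sum : \sum_j finite_information m (c j) =
  \sum_k \sum_u P k u * ln (P k u / (m k * Q u)).
Proof.
under [RHS]eq_bigr => k _ do under eq_bigr => u _ do
  rewrite -lnB mulr_sumr.
under [RHS]eq_bigr => k _ do rewrite exchange_big/=.
rewrite [RHS]exchange_big/=; apply: eq_bigr => j _; apply: eq_bigr => k _.
rewrite [RHS](partition_big (fun u : {ffun J -> I} => u j) predT)//=.
apply: eq_bigr => l _; rewrite -{1}Pmarg mulr_suml.
by apply: eq_bigr => u /eqP ->.
Qed.

(* Data processing and conditional independence in one application of
   ln z <= z - 1, over all triples (x, u, x'). *)
Lemma posterior_information :
  finite_information m p <= \sum_j finite_information m (c j).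
Proof.
rewrite info_sum.
have [p0 pl pr] := posterior_couplingP.
(* The comparison law on triples: u is drawn from [Q], x' from the posterior given u, then x from
   the conditional law of X given X' = x'. It is chosen so that ln (W / q) is the difference of the
   two information densities. *)
pose q k u l : R := P l u / Pu u * (p k l / m l) * Q u.
have Q0 u : 0 < Q u by exact: prodr_gt0.
have q0 k u l : 0 <= q k u l.
  apply: mulr_ge0; last exact: ltW.
  by apply: mulr_ge0; apply: divr_ge0 => //; exact: ltW.
have key k u l : W k u l - q k u l <=
   W k u l * ln (P k u / (m k * Q u)) - W k u l * ln (p k l / (m k * m l)).
  have [W_gt0|W_le0] := ltP 0 (W k u l); last first.
    have -> : W k u l = 0 by apply/le_anti; rewrite W_le0 W0.
    by rewrite !mul0r subrr sub0r oppr_le0.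
  have P1 : 0 < P k u.
    by rewrite lt_neqAle P0 andbT eq_sym; apply: contraTneq W_gt0 => e;
      rewrite /W e !mul0r ltxx.
  have P2 : 0 < P l u.
    by rewrite lt_neqAle P0 andbT eq_sym; apply: contraTneq W_gt0 => e;
      rewrite /W e mulr0 !mul0r ltxx.
  have P3 : 0 < Pu u by exact: lt_le_trans (P_le_Pu k u).
  have p_gt0 : 0 < p k l.
    by apply: (lt_le_trans W_gt0); rewrite /p (bigD1 u)//= lerDl sumr_ge0.
  have q_gt0 : 0 < q k u l.
    by apply: mulr_gt0 => //; apply: mulr_gt0; exact: divr_gt0.
  have A0 : P k u / (m k * Q u) \is Num.pos.
    by apply: divr_gt0 => //; exact: mulr_gt0.
  have B0 : p k l / (m k * m l) \is Num.pos.
    by apply: divr_gt0 => //; exact: mulr_gt0.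
  rewrite -mulrBr -ln_div//.
  have -> : P k u / (m k * Q u) / (p k l / (m k * m l)) = W k u l / q k u l.
    by rewrite /W /q; field; rewrite !gt_eqF.
  exact: subr_le_mul_ln.
have qsum : \sum_k \sum_u \sum_l q k u l <= 1.
  have -> : \sum_k \sum_u \sum_l q k u l =
            \sum_u \sum_l (P l u / Pu u * Q u).
    rewrite [LHS]exchange_big/=; apply: eq_bigr => u _.
    rewrite [LHS]exchange_big/=; apply: eq_bigr => l _; rewrite -mulr_suml -mulr_sumr -mulr_suml.
    by rewrite pr divff ?gt_eqF// mulr1.
  have -> : 1 = \sum_u Q u :> R.
    rewrite -(bigA_distr_bigA (fun (j : J) l => m l)) big1//.
  apply: ler_sum => u _; rewrite -mulr_suml -mulr_suml -/(Pu u).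
  (* Values u without a posterior lose their mass under [Q]; this is why the total mass of [q] is
     only bounded by 1. *)
  have [h|h] := eqVneq (Pu u) 0; first by rewrite h !mul0r ltW.
  by rewrite divff// mul1r.
have Wsum : \sum_k \sum_u \sum_l W k u l = 1.
  rewrite -m_sum; apply: eq_bigr => k _; under eq_bigr do rewrite Wsuml.
  exact: Psum.
have -> : finite_information m p =
    \sum_k \sum_u \sum_l W k u l * ln (p k l / (m k * m l)).
  apply: eq_bigr => k _; rewrite [RHS]exchange_big/=; apply: eq_bigr => l _.
  by rewrite -mulr_suml.
have -> : \sum_k \sum_u P k u * ln (P k u / (m k * Q u)) =
    \sum_k \sum_u \sum_l W k u l * ln (P k u / (m k * Q u)).
  apply: eq_bigr => k _; apply: eq_bigr => u _.
  by rewrite -mulr_suml Wsuml.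
rewrite -subr_ge0 -sumrB.
under eq_bigr do rewrite -sumrB.
under eq_bigr do under eq_bigr do rewrite -sumrB.
(* By [key] the gap between the informations is at least the mass of [W], which is 1, minus that of
   [q]. *)
apply: le_trans (_ : 0 <= \sum_k \sum_u \sum_l (W k u l - q k u l)) _.
  under eq_bigr do under eq_bigr do rewrite sumrB.
  under eq_bigr do rewrite sumrB.
  by rewrite sumrB Wsum subr_ge0.
by apply: ler_sum => k _; apply: ler_sum => u _; apply: ler_sum => l _; exact: key.
Qed.

(** The hypothesis on f and g is summed against [W] with h = u j. Both (X, X_j) and (X', X_j) have
    law [c j], so the two legs cost the same, hence the factor 2. *)
Lemma posterior_cost j (f g : I -> I -> \bar R) :
    (forall k l, (0 <= g k l)%E) ->
    (forall k l, (0 <= f k l)%E) ->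
    (forall k l h, (f k l <= g k h + g l h)%E) ->
  (\sum_k \sum_l (p k l)%:E * f k l <=
     2%:E * \sum_k \sum_l (c j k l)%:E * g k l)%E.
Proof.
move=> g0 f0 fg.
have -> : (\sum_k \sum_l (p k l)%:E * f k l =
    \sum_k \sum_l \sum_u (W k u l)%:E * f k l)%E.
  apply: eq_bigr => k _; apply: eq_bigr => l _.
  rewrite /p -sumEFin ge0_sume_distrl// => u _; by rewrite lee_fin.
have Wg : (\sum_k \sum_l \sum_u (W k u l)%:E * g k (u j) =
    \sum_k \sum_l (c j k l)%:E * g k l)%E.
  apply: eq_bigr => k _; rewrite exchange_big/=.
  under eq_bigr => u _.
    rewrite -ge0_sume_distrl; last by move=> l _; rewrite lee_fin.
    rewrite sumEFin Wsuml; over.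
  rewrite [LHS](partition_big (fun u : {ffun J -> I} => u j) predT)//=.
  apply: eq_bigr => l _; rewrite -Pmarg -sumEFin ge0_sume_distrl.
    by apply: eq_bigr => u /eqP ->.
  by move=> u _; rewrite lee_fin.
have Wg' : (\sum_k \sum_l \sum_u (W k u l)%:E * g l (u j) =
    \sum_k \sum_l (c j k l)%:E * g k l)%E.
  rewrite -Wg exchange_big; apply: eq_bigr => k _; apply: eq_bigr => l _.
  by apply: eq_bigr => u _; rewrite WC.
rewrite mule_natl mule2n -{1}Wg -Wg' -big_split; apply: lee_sum => k _.
rewrite -big_split /=; apply: lee_sum => l _; rewrite -big_split /=; apply: lee_sum => u _.
by rewrite -ge0_muleDr// lee_wpmul2l// lee_fin.
Qed.

End mixture.
End finite_couplings.

(** * Integration against a finitely supported law *)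

Section finite_support_integral.
Local Open Scope ereal_scope.
Context d (T : measurableType d) (R : realType).

(* No measurability is required: the integral of a nonnegative function is a
   supremum over the simple functions below it. *)
Lemma ge0_le_integralT (mu : {measure set T -> \bar R}) (f g : T -> \bar R) :
  (forall x, 0 <= f x) -> (forall x, f x <= g x) ->
  \int[mu]_x f x <= \int[mu]_x g x.
Proof.
move=> f0 fg.
have g0 x : 0 <= g x by rewrite (le_trans _ (fg x)).
rewrite !ge0_integralTE//; apply: le_ereal_sup => _ [h hf <-].
by exists h => // x; rewrite (le_trans (hf x)).
Qed.

Hypothesis measurable_point : forall x : T, measurable [set x].

Lemma finite_set_measurable (D : set T) : finite_set D -> measurable D.
Proof. by move=> /finite_set_countable; exact: countable_measurable. Qed.

Lemma measurable_fun_finite_support (D : set T) (f : T -> \bar R) (c : \bar R) :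
  finite_set D -> (forall x, ~ D x -> f x = c) -> measurable_fun [set: T] f.
Proof.
move=> finD fc _ B mB; rewrite setTI.
rewrite -(setUIDK (f @^-1` B) D); apply: measurableU.
  by apply: finite_set_measurable; exact: finite_setIr.
have [Bc|Bc] := pselect (B c).
  rewrite [X in measurable X](_ : _ = ~` D).
    by apply: measurableC; exact: finite_set_measurable.
  apply/seteqP; split => [x []//|x nDx]; split => //=.
  by rewrite fc.
rewrite [X in measurable X](_ : _ = set0)//.
by rewrite -subset0 => x [/= fB /fc fxc]; apply: Bc; rewrite -fxc.
Qed.

Context (J : finType) (z : J -> T) (z_inj : injective z).
Context (nu : probability T R).
Hypothesis nu_supp : nu (~` range z) = 0.

Let finz : finite_set (range z).
Proof. exact: finite_image. Qed.

Lemma ge0_integral_finite_support (f : T -> \bar R) : (forall x, 0 <= f x) ->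
  \int[nu]_x f x = \sum_j nu [set z j] * f (z j).
Proof.
move=> f0.
have mz := finite_set_measurable finz.
transitivity (\int[nu]_(x in range z) f x).
  (* As f may fail to be measurable, the null complement cannot be removed from its integral
     directly. The majorant [g] is measurable, being constant off a finite set, and agrees with f on
     the support; the reverse inequality compares f with its extension by 0. *)
  pose g x := if x \in range z then f x else +oo.
  have mg : measurable_fun [set: T] g.
    apply: (measurable_fun_finite_support finz (c := +oo)) => x zx.
    by rewrite /g memNset.
  have g0 x : 0 <= g x by rewrite /g; case: ifP.
  apply/eqP; rewrite eq_le; apply/andP; split.
    apply: (@le_trans _ _ (\int[nu]_x g x)).
      by apply: ge0_le_integralT => // x; rewrite /g; case: ifP => // _; rewrite leey.
    rewrite (ge0_negligible_integral (measurableC mz))// setTD setCK.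
    rewrite le_eqVlt; apply/orP; left; apply/eqP; apply: eq_integral => x xz.
    by rewrite /g xz.
  rewrite integral_mkcond; apply: ge0_le_integralT => x.
    by rewrite patchE; case: ifP.
  by rewrite patchE; case: ifP.
have rE : range z = \big[setU/set0]_(j <- index_enum J) [set z j].
  rewrite -bigcup_seq; apply/seteqP; split => [_ [j _ <-]|x [j _ ->]].
    by exists j => //=; rewrite mem_index_enum.
  by exists j.
rewrite {1}rE ge0_integral_bigsetU//=.
- apply: eq_bigr => j _.
  rewrite (eq_integral (cst (f (z j)))); last by move=> x; rewrite inE => ->.
  by rewrite integral_cst// muleC.
- exact: index_enum_uniq.
- apply/trivIsetP => i j _ _ ij; apply/seteqP; split => // x [-> /z_inj /eqP].
  by rewrite (negPf ij).
- rewrite -rE => _ B mB; apply: finite_set_measurable; exact: finite_setIl.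
Qed.

Lemma measure_finite_support (A : set T) : measurable A ->
  nu A = \sum_j nu [set z j] * (\1_A (z j))%:E.
Proof.
move=> mA; rewrite -[in LHS](setIT A) -integral_indic//.
by rewrite ge0_integral_finite_support// => x; rewrite lee_fin.
Qed.

(** Finiteness at the points of positive mass prevents an indeterminate difference when the positive
    and negative parts are recombined. Infinite values at null points must be allowed: the
    log-density is -oo at the pairs of mass zero. *)
Lemma integral_finite_support (f : T -> \bar R) :
    (forall j, nu [set z j] != 0 -> f (z j) \is a fin_num) ->
  \int[nu]_x f x = \sum_j nu [set z j] * f (z j).
Proof.
move=> ffin; rewrite integralE !ge0_integral_finite_support//.
have fin j : nu [set z j] \is a fin_num by exact: fin_num_measure.
rewrite -fin_num_sumeN => [|j _].
  rewrite -big_split/=; apply: eq_bigr => j _.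
  have [->|nuj0] := eqVneq (nu [set z j]) 0; first by rewrite !mul0e oppe0 adde0.
  have fj := ffin _ nuj0.
  have -> : f (z j) = f^\+ (z j) - f^\- (z j) by rewrite {1}(funeposneg f).
  rewrite muleBr// fin_num_adde_defl// fin_numN.
  by rewrite funenegE /maxe; case: ifPn; rewrite ?fin_numN.
have [->|nuj0] := eqVneq (nu [set z j]) 0; first by rewrite mul0e.
by rewrite fin_numM// funenegE /maxe; case: ifPn; rewrite ?fin_numN// ffin.
Qed.

End finite_support_integral.

(** * Couplings of a finitely supported law as matrices *)

Section discrete_couplings.
Local Open Scope ereal_scope.
Context d (T : measurableType d) (R : realType).
Hypothesis measurable_point : forall x : T, measurable [set x].

Context (mu : probability T R) (I : finType) (x : I -> T).
Hypotheses (x_inj : injective x) (mu_pos : forall k, 0 < mu [set x k]).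
Hypothesis mu_supp : mu (~` range x) = 0.

Let m k : R := fine (mu [set x k]).

Let xx (kl : I * I) : T * T := (x kl.1, x kl.2).

Let xx_inj : injective xx.
Proof. by move=> [k l] [k' l'] [/x_inj -> /x_inj ->]. Qed.

Let mE k : mu [set x k] = (m k)%:E.
Proof. by rewrite fineK// fin_num_measure. Qed.

Lemma mass_gt0 k : (0 < m k)%R.
Proof. by rewrite -lte_fin -mE. Qed.

Lemma measurable_point2 (z : T * T) : measurable [set z].
Proof.
have -> : [set z] = [set z.1] `*` [set z.2].
  by apply/seteqP; split => [_ ->//|[a b] /= [-> ->]]; case: z.
exact: measurableX.
Qed.

Lemma mass_sum : (\sum_k m k = 1)%R.
Proof.
apply: EFin_inj; rewrite -sumEFin.
rewrite -(probability_setT mu).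
rewrite (measure_finite_support measurable_point x_inj mu_supp)//.
by apply: eq_bigr => k _; rewrite indicT mule1 mE.
Qed.

Section decode.
Context (joint : probability (T * T)%type R).
Hypothesis joint_coupling : coupling mu mu joint.

Definition joint_mass k l : R := fine (joint [set xx (k, l)]).
Local Notation p := joint_mass.

Let pE kl : joint [set xx kl] = (p kl.1 kl.2)%:E.
Proof. by case: kl => k l; rewrite fineK// fin_num_measure//; exact: measurable_point2. Qed.

Let mrange : measurable (range x).
Proof. by apply: finite_set_measurable => //; exact: finite_image. Qed.

Let joint_fst A : measurable A -> joint (A `*` setT) = mu A.
Proof.
move=> mA; rewrite -(joint_coupling.1 _ mA); congr (joint _).
by apply/seteqP; split => [z []|z].
Qed.

Let joint_snd A : measurable A -> joint (setT `*` A) = mu A.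
Proof.
move=> mA; rewrite -(joint_coupling.2 _ mA); congr (joint _).
by apply/seteqP; split => [z []|z].
Qed.

(** Off the grid one of the coordinates leaves the support, so the complement is covered by two
    strips that the marginals make null. *)
Lemma joint_supp : joint (~` range xx) = 0.
Proof.
have mC := measurableC mrange.
apply/eqP; rewrite -measure_le0.
apply: (@le_trans _ _ (joint ((~` range x) `*` setT `|` setT `*` (~` range x)))).
  apply: le_measure; rewrite ?inE.
  - apply: measurableC; apply: finite_set_measurable; first exact: measurable_point2.
    exact: finite_image.
  - by apply: measurableU; exact: measurableX.
  move=> [a b] /= h; have [[k _ ka]|?] := pselect (range x a); last by left.
  right; split => // -[l _ lb]; apply: h; exists (k, l) => //.
  by rewrite /xx/= ka lb.
have h : joint ((~` range x) `*` setT `|` setT `*` (~` range x)) <=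
    joint ((~` range x) `*` setT) + joint (setT `*` (~` range x)).
  by apply: measureU2; exact: measurableX.
by rewrite (le_trans h)// joint_fst// joint_snd// mu_supp adde0.
Qed.

Lemma joint_integral (f : T * T -> \bar R) : (forall z, 0 <= f z) ->
  \int[joint]_z f z = \sum_k \sum_l (p k l)%:E * f (x k, x l).
Proof.
move=> f0; rewrite (ge0_integral_finite_support measurable_point2 xx_inj joint_supp)//.
rewrite pair_big; apply: eq_bigr => kl _.
by rewrite pE.
Qed.

Lemma joint_mass_coupling : finite_coupling m p.
Proof.
split => [k l|k|l]; first exact: fine_ge0.
- apply: EFin_inj; rewrite -mE -joint_fst// -sumEFin.
  rewrite (measure_finite_support measurable_point2 xx_inj joint_supp)//; last first.
    exact: measurableX.
  transitivity (\sum_k' \sum_l (p k' l)%:E * (k' == k)%:R%:E).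
    rewrite [RHS](bigD1 k)//= [X in _ + X]big1 ?adde0 => [|k' /negPf ->].
      by apply: eq_bigr => l _; rewrite eqxx mule1.
    by rewrite big1// => l _; rewrite mule0.
  rewrite pair_big; apply: eq_bigr => -[a b] _ /=.
  rewrite pE; congr (_ * _%:E); rewrite indicE; congr (nat_of_bool _)%:R.
  apply/idP/idP => [/eqP ->|]; first by rewrite inE.
  by rewrite inE => -[/= /x_inj ->].
- apply: EFin_inj; rewrite -mE -joint_snd// -sumEFin.
  rewrite (measure_finite_support measurable_point2 xx_inj joint_supp)//; last first.
    exact: measurableX.
  transitivity (\sum_k \sum_l' (p k l')%:E * (l' == l)%:R%:E).
    apply: eq_bigr => k _; rewrite (bigD1 l)//= eqxx mule1.
    by rewrite big1 ?adde0// => l' /negPf ->; rewrite mule0.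
  rewrite pair_big; apply: eq_bigr => -[a b] _ /=.
  rewrite pE; congr (_ * _%:E); rewrite indicE; congr (nat_of_bool _)%:R.
  apply/idP/idP => [/eqP ->|]; first by rewrite inE.
  by rewrite inE => -[/= _ /x_inj ->].
Qed.

Let Q := product_law (distribution joint fst) (distribution joint snd).

Let QE kl : Q [set xx kl] = (m kl.1 * m kl.2)%:E.
Proof.
have -> : [set xx kl] = [set x kl.1] `*` [set x kl.2].
  by apply/seteqP; split => [_ ->//|[a b] /= [-> ->]].
transitivity (distribution joint fst [set x kl.1] *
              distribution joint snd [set x kl.2]).
  exact: product_measure1E.
by rewrite joint_coupling.1// joint_coupling.2// !mE.
Qed.

(** Every grid point has product mass m k m l > 0, so a null set of the product law avoids the grid,
    which carries [joint]. *)
Let joint_ac : joint `<< Q.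
Proof.
move=> A QA0 B mB BA.
rewrite (measure_finite_support measurable_point2 xx_inj joint_supp)//.
apply: big1 => kl _; rewrite indicE; case: (boolP (_ \in B)); last by rewrite mule0.
rewrite inE => Bkl.
have : Q [set xx kl] = 0.
  by apply: QA0; [exact: measurable_point2|move=> _ ->; exact: BA].
by rewrite QE => -[/eqP]; rewrite gt_eqF// mulr_gt0// mass_gt0.
Qed.

Lemma mutual_information_finite :
  mutual_information joint = (finite_information m p)%:E.
Proof.
rewrite /mutual_information /relative_entropy -/Q asboolT//.
set f := Radon_Nikodym _ _.
(* A Radon-Nikodym derivative is determined only almost everywhere, but the positive mass of the
   grid points forces its values there. *)
have fE kl : f (xx kl) = (p kl.1 kl.2 / (m kl.1 * m kl.2))%:E.
  have mz := measurable_point2 (xx kl).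
  have m0 : (0 < m kl.1 * m kl.2)%R by rewrite mulr_gt0// mass_gt0.
  have ffin : f (xx kl) \is a fin_num by exact: Radon_Nikodym_fin_num.
  have : joint [set xx kl] = f (xx kl) * Q [set xx kl].
    rewrite -[LHS]/(charge_of_finite_measure joint [set xx kl]).
    have ac : charge_of_finite_measure joint `<< Q by exact: joint_ac.
    rewrite (Radon_Nikodym_integral ac mz) -/f.
    rewrite (eq_integral (cst (f (xx kl)))) => [|z]; last by rewrite inE => ->.
    exact: integral_cst.
  rewrite pE QE -(fineK ffin) -EFinM => -[->].
  by rewrite mulfK// gt_eqF.
have lnf kl : (0 < p kl.1 kl.2)%R ->
    lne (f (xx kl)) = (ln (p kl.1 kl.2 / (m kl.1 * m kl.2)))%:E.
  by move=> p0; rewrite fE lne_EFin// divr_gt0// mulr_gt0// mass_gt0.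
have p0 k l : (0 <= p k l)%R by case: joint_mass_coupling.
rewrite (integral_finite_support measurable_point2 xx_inj joint_supp)//.
  rewrite /finite_information -sumEFin.
  under [RHS]eq_bigr do rewrite -sumEFin.
  rewrite pair_big; apply: eq_bigr => kl _; rewrite pE EFinM.
  have [pkl|] := ltP 0%R (p kl.1 kl.2); first by rewrite lnf.
  move=> pkl; have -> : p kl.1 kl.2 = 0%R by apply/le_anti; rewrite pkl p0.
  by rewrite !mul0e.
by move=> kl; rewrite pE => pkl; rewrite lnf// lt_neqAle p0 andbT eq_sym.
Qed.

End decode.

Lemma finite_coupling_joint (p : I -> I -> R) : finite_coupling m p ->
  exists joint : probability (T * T)%type R,
    coupling mu mu joint /\ forall k l, joint_mass joint k l = p k l.
Proof.
move=> cp; have [p0 pl pr] := cp.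
(* The measure is a sum of weighted Dirac masses. Since [msum] takes a sequence of measures, the
   pairs are enumerated and the sequence is completed by the zero measure. *)
pose F (i : nat) : {measure set (T * T)%type -> \bar R} :=
  if insub i is Some o then
    let kl := enum_val (o : 'I_#|{: I * I}|) in
    mscale (NngNum (p0 kl.1 kl.2)) (\d_(xx kl))
  else mzero.
pose M := msum F #|{: I * I}|.
have ME A : M A = \sum_k \sum_l (p k l)%:E * (\1_A (xx (k, l)))%:E.
  rewrite pair_big /M /msum/= [RHS](reindex _ (onW_bij _ (@enum_val_bij (I * I)%type)))/=.
  apply: eq_bigr => i _.
  rewrite /F; case: insubP => [h _ h_i|]; last by rewrite ltn_ord.
  have -> : h = i by exact: val_inj.
  by rewrite /mscale/= -surjective_pairing.
have M1 : M setT = 1.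
  rewrite ME; under eq_bigr do under eq_bigr do rewrite indicT mule1.
  under eq_bigr => k _ do rewrite sumEFin pl.
  by rewrite sumEFin mass_sum.
pose P : probability (T * T)%type R :=
  HB.pack M (Measure_isProbability.Build _ _ _ M M1).
exists P; split; first split.
- move=> A mA; rewrite (measure_finite_support measurable_point x_inj mu_supp)//.
  transitivity (M (fst @^-1` A)) => //; rewrite ME; apply: eq_bigr => k _.
  rewrite mE -pl -sumEFin ge0_sume_distrl; last by move=> l _; rewrite lee_fin.
  by apply: eq_bigr => l _; rewrite !indicE.
- move=> A mA; rewrite (measure_finite_support measurable_point x_inj mu_supp)//.
  transitivity (M (snd @^-1` A)) => //; rewrite ME exchange_big; apply: eq_bigr => l _.
  rewrite mE -pr -sumEFin ge0_sume_distrl; last by move=> k _; rewrite lee_fin.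
  by apply: eq_bigr => k _; rewrite !indicE.
- move=> k l; rewrite /joint_mass -[P _]/(M _) ME.
  rewrite (bigD1 k)//= (bigD1 l)//= big1 => [|l' /negPf ll'].
    rewrite big1 => [|k' /negPf kk'].
      by rewrite indicE mem_set// mule1 !adde0.
    apply: big1 => l' _; rewrite indicE memNset ?mule0//= => /xx_inj [] /eqP.
    by rewrite kk'.
  by rewrite indicE memNset ?mule0//= => /xx_inj [] /eqP; rewrite ll'.
Qed.

End discrete_couplings.

(** * Atoms of a finitely supported law on tuples *)

Lemma measurable_tuple_point (R : realType) n (x : n.-tuple R) :
  measurable [set x].
Proof.
have -> : [set x] = \bigcap_(i in [set: 'I_n]) ((@tnth n R)^~ i @^-1` [set tnth x i]).
  apply/seteqP; split => [_ ->//|y h].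
  by apply: eq_from_tnth => i; exact: h.
apply: fin_bigcap_measurable => // i _; rewrite -[X in measurable X]setTI.
exact: measurable_tnth.
Qed.

(** The given finite set may contain null points. They are discarded, because the finite theory
    divides by the masses. *)
Lemma finitely_supported_points (R : realType) n
    (mu : probability (n.-tuple R) R) : finitely_supported mu ->
  exists (I : finType) (x : I -> n.-tuple R),
    [/\ injective x, forall k, (0 < mu [set x k])%E & mu (~` range x) = 0%E].
Proof.
move=> [S finS muS].
pose A := [set x | S x /\ (0 < mu [set x])%E].
have finA : finite_set A by apply: sub_finite_set finS => x [].
pose s := finmap.enum_fset (fset_set A).
have sA (y : seq_sub s) : A (val y).
  by have := valP y; rewrite /s/= in_fset_set// inE.
exists (seq_sub s), val; split.
- exact: val_inj.
- by move=> k; case: (sA k).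
have mS := finite_set_measurable (@measurable_tuple_point R n) finS.
have finr : finite_set (range (val : seq_sub s -> n.-tuple R)) by exact: finite_image.
have mr := finite_set_measurable (@measurable_tuple_point R n) finr.
have muSC : mu (~` S) = 0%E by rewrite probability_setC// muS subee.
apply/eqP; rewrite -measure_le0.
have finD : finite_set (S `\` range (val : seq_sub s -> n.-tuple R)) by exact: finite_setD.
have mD := finite_set_measurable (@measurable_tuple_point R n) finD.
have muD : mu (S `\` range (val : seq_sub s -> n.-tuple R)) = 0%E.
  set D := _ `\` _ in finD *.
  have DE : D = \bigcup_(y in D) [set y].
    by apply/seteqP; split => [y Dy|y [z Dz ->]]//; exists y.
  rewrite {1}DE measure_fin_bigcup//=.
  - apply: fsbig1 => y [Sy ny]; apply/eqP; rewrite -measure_le0 leNgt.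
    apply/negP => y0; apply: ny.
    have ys : y \in s by rewrite /s/= in_fset_set// inE.
    by exists (SeqSub ys).
  - by apply/trivIsetP => i j _ _ /eqP ij; apply/seteqP; split => // y [] /= -> /ij.
  - by move=> y _; exact: measurable_tuple_point.
apply: (@le_trans _ _ (mu (~` S `|` S `\` range (val : seq_sub s -> _)))%E).
  apply: le_measure; rewrite ?inE; [exact: measurableC|exact: measurableU (measurableC mS) mD|].
  by move=> y h; have [Sy|nSy] := pselect (S y); [right|left].
have h : (mu (~` S `|` S `\` range (val : seq_sub s -> _)) <= mu (~` S) + mu (S `\` range (val : seq_sub s -> _)))%E.
  by apply: measureU2; [exact: measurableC|exact: mD].
by rewrite (le_trans h)// muSC muD adde0.
Qed.

(** * Comparison of rate-distortion functions at a fixed scale *)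

Section pointwise.
Local Open Scope ereal_scope.
Context (R : realType) (n : nat) (mu : probability (n.-tuple R) R).
Context (I : finType) (x : I -> n.-tuple R).
Hypotheses (x_inj : injective x) (mu_pos : forall k, 0 < mu [set x k]).
Hypothesis mu_supp : mu (~` range x) = 0.

Let mp := @measurable_tuple_point R n.

Let m k : R := fine (mu [set x k]).

Let m_gt0 : forall k, (0 < m k)%R. Proof. by move=> k; exact: mass_gt0. Qed.

Let m_sum : (\sum_k m k = 1)%R. Proof. exact: (mass_sum mp x_inj mu_supp). Qed.

Lemma distortion_ge0 (d : 'I_n -> R -> \bar R) t y z :
  (forall i r, (0 <= r)%R -> 0 <= d i r) -> (0 < t)%R -> 0 <= distortion d t y z.
Proof.
move=> d0 t0; apply: sume_ge0 => i _; apply: d0.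
by rewrite divr_ge0// ltW.
Qed.

Section one_cost.
Context (d : 'I_n -> R -> \bar R) (t : R).
Hypotheses (d0 : forall i r, (0 <= r)%R -> 0 <= d i r) (t0 : (0 < t)%R).

Let D0 y z : 0 <= distortion d t y z. Proof. exact: distortion_ge0. Qed.

(** With [rate_distortion_value], this turns the rate-distortion function into an infimum over
    matrices with prescribed marginals. *)
Lemma rate_distortion_le (p : I -> I -> R) : finite_coupling m p ->
  rate_distortion d mu t <= (finite_information m p)%:E +
     \sum_k \sum_l (p k l)%:E * distortion d t (x k) (x l).
Proof.
move=> cp; have [joint [cj jp]] := finite_coupling_joint mp x_inj mu_supp cp.
apply: ereal_inf_lbound; exists joint => //.
rewrite (mutual_information_finite mp x_inj mu_pos mu_supp cj).
rewrite (joint_integral mp x_inj mu_supp cj (f := fun z => distortion d t z.1 z.2))//.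
by have -> : joint_mass x joint = p by apply/funext => k; apply/funext => l.
Qed.

Lemma rate_distortion_value (joint : probability (n.-tuple R * n.-tuple R)%type R) :
    coupling mu mu joint ->
  exists2 p, finite_coupling m p &
    mutual_information joint + \int[joint]_z distortion d t z.1 z.2 =
    (finite_information m p)%:E +
     \sum_k \sum_l (p k l)%:E * distortion d t (x k) (x l).
Proof.
move=> cj; exists (joint_mass x joint).
  exact: (joint_mass_coupling mp x_inj mu_supp cj).
rewrite (mutual_information_finite mp x_inj mu_pos mu_supp cj).
by rewrite (joint_integral mp x_inj mu_supp cj (f := fun z => distortion d t z.1 z.2)).
Qed.

Let cost_ge0 p : finite_coupling m p ->
  0 <= \sum_k \sum_l (p k l)%:E * distortion d t (x k) (x l).
Proof.
move=> [p0 _ _]; apply: sume_ge0 => k _; apply: sume_ge0 => l _.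
by rewrite mule_ge0// lee_fin.
Qed.

Lemma rate_distortion_ge0 : 0 <= rate_distortion d mu t.
Proof.
apply: le_ereal_inf_tmp => _ [joint /rate_distortion_value [p cp ->] <-].
by rewrite adde_ge0 ?cost_ge0// lee_fin (finite_information_ge0 m_sum).
Qed.

Lemma rate_distortion_adherent (eps : R) : (0 < eps)%R ->
    rate_distortion d mu t != +oo ->
  exists2 p, finite_coupling m p &
    (finite_information m p)%:E +
      \sum_k \sum_l (p k l)%:E * distortion d t (x k) (x l) <=
    rate_distortion d mu t + eps%:E.
Proof.
move=> e0 RDoo.
have fin : rate_distortion d mu t \is a fin_num.
  by rewrite ge0_fin_numE ?rate_distortion_ge0// ltey.
have [_ [joint /rate_distortion_value [p cp ->] <-] lt_e] :=
  lb_ereal_inf_adherent e0 fin.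
by exists p => //; exact: ltW.
Qed.

End one_cost.

Context (d e : 'I_n -> R -> \bar R).
Hypotheses (d0 : forall i r, (0 <= r)%R -> 0 <= d i r)
  (e0 : forall i r, (0 <= r)%R -> 0 <= e i r)
  (e_nd : forall i r s, (0 <= r)%R -> (r <= s)%R -> e i r <= e i s)
  (de : forall i r J, (0 <= r)%R -> (0 < J)%N ->
    d i r <= 4%:E * \sum_(j < J) e i (2 * r / 2 ^+ j)%R
             + (2 * r ^+ 2 / 2 ^+ J)%R%:E).

(* The scale t 2^j / 4 pays for the triangle inequality through the j-th
   intermediate point. *)
Let sc (t : R) (j : nat) : R := (2 ^+ j * t / 4)%R.

(** At least one of the two distances to c is half of |a - b| or more, so monotonicity and
    nonnegativity of e suffice. The scale [sc t j] is such that 2 (r / t) / 2^j = (r / 2) /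
    [sc t j]. *)
Let e_triangle i (t : R) j (a b c : R) : (0 < t)%R ->
  e i (2 * (`|a - b| / t) / 2 ^+ j)%R <=
  e i (`|a - c| / sc t j)%R + e i (`|b - c| / sc t j)%R.
Proof.
move=> t0.
have s0 : (0 < sc t j)%R by rewrite /sc divr_gt0// mulr_gt0// exprn_gt0.
have scE r : (2 * (r / t) / 2 ^+ j = r / 2 / sc t j)%R.
  by rewrite /sc; field; rewrite gt_eqF//= expf_neq0.
have tri : (`|a - b| <= `|a - c| + `|b - c|)%R by rewrite (distrC b c) ler_distD.
have h0 r : (0 <= `|r| / sc t j)%R by rewrite divr_ge0// ltW.
rewrite scE; have [ab|/ltW ab] := leP `|b - c|%R `|a - c|%R.
  apply: (@le_trans _ _ (e i (`|a - c| / sc t j)%R)); last by rewrite leeDl// e0.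
  apply: e_nd; first by apply: divr_ge0; [exact: divr_ge0|exact: ltW].
  rewrite ler_pM2r ?invr_gt0//; lra.
apply: (@le_trans _ _ (e i (`|b - c| / sc t j)%R)); last by rewrite leeDr// e0.
apply: e_nd; first by apply: divr_ge0; [exact: divr_ge0|exact: ltW].
rewrite ler_pM2r ?invr_gt0//; lra.
Qed.

(** Bounds the mean of the quadratic remainder, up to 1 / (t^2 2^J), uniformly over couplings, as
    the entries of a coupling are at most 1. *)
Let K : R := (\sum_k \sum_l \sum_(i < n) 2 * (`|tnth (x k) i - tnth (x l) i|) ^+ 2)%R.

Lemma rate_distortion_sum_le (t : R) J : (0 < t)%R -> (0 < J)%N ->
  rate_distortion d mu t <=
    8%:E * \sum_(j < J) rate_distortion e mu (sc t j)
    + (K / t ^+ 2 / 2 ^+ J)%R%:E.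
Proof.
move=> t0 J0.
have s0 j : (0 < sc t j)%R by rewrite /sc divr_gt0// mulr_gt0// exprn_gt0.
have RD0 j : 0 <= rate_distortion e mu (sc t j) by exact: rate_distortion_ge0.
have [/existsP[j /eqP jy]|] := boolP [exists j : 'I_J, rate_distortion e mu (sc t j) == +oo].
  have -> : \sum_(j < J) rate_distortion e mu (sc t j) = +oo.
    apply/eqP; rewrite esum_eqy => [|i _].
      by apply/existsP; exists j; rewrite jy eqxx.
    by rewrite gt_eqF// (lt_le_trans _ (RD0 i)).
  by rewrite gt0_muley// addye// leey.
rewrite negb_exists => /forallP fin.
apply/lee_addgt0Pr => eps eps0.
(* The J errors will each be multiplied by 8, so these shares add up to [eps]. *)
have eps'0 : (0 < eps / (8 * J%:R))%R by rewrite divr_gt0// mulr_gt0// ltr0n.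
have /fin_all_exists2[p cp pe] : forall j : 'I_J, exists2 p, finite_coupling m p &
    (finite_information m p)%:E +
      \sum_k \sum_l (p k l)%:E * distortion e (sc t j) (x k) (x l) <=
    rate_distortion e mu (sc t j) + (eps / (8 * J%:R))%:E.
  by move=> j; exact: rate_distortion_adherent.
pose P := posterior_coupling m p.
have cP : finite_coupling m P by exact: posterior_couplingP.
have [P0 _ _] := cP.
apply: (le_trans (rate_distortion_le d0 t0 cP)).
pose F j k l : \bar R :=
  \sum_(i < n) 4%:E * e i (2 * (`|tnth (x k) i - tnth (x l) i| / t) / 2 ^+ j)%R.
pose T k l : R := (\sum_(i < n) 2 * (`|tnth (x k) i - tnth (x l) i| / t) ^+ 2 / 2 ^+ J)%R.
have r0 k l i : (0 <= `|tnth (x k) i - tnth (x l) i| / t)%R.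
  by apply: divr_ge0 => //; exact: ltW.
have r0' k l i j : (0 <= 2 * (`|tnth (x k) i - tnth (x l) i| / t) / 2 ^+ j)%R.
  by apply: divr_ge0; [exact: mulr_ge0|exact: exprn_ge0].
have F0 j k l : 0 <= F j k l.
  by apply: sume_ge0 => i _; apply: mule_ge0; [rewrite lee_fin|exact: e0].
have T0 k l : (0 <= T k l)%R.
  apply: sumr_ge0 => i _; apply: divr_ge0; last exact: exprn_ge0.
  by apply: mulr_ge0 => //; exact: sqr_ge0.
have DF k l : distortion d t (x k) (x l) <= \sum_(j < J) F j k l + (T k l)%:E.
  rewrite /F exchange_big -sumEFin -big_split; apply: lee_sum => i _ /=.
  rewrite -ge0_sume_distrr; last by move=> j _; exact: e0.
  exact: de.
have PT : (\sum_k \sum_l P k l * T k l <= K / t ^+ 2 / 2 ^+ J)%R.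
  rewrite /K !mulr_suml; apply: ler_sum => k _.
  rewrite !mulr_suml; apply: ler_sum => l _.
  have -> : ((\sum_(i < n) 2 * `|tnth (x k) i - tnth (x l) i| ^+ 2) / t ^+ 2 / 2 ^+ J
      = T k l)%R.
    rewrite !mulr_suml; apply: eq_bigr => i _.
    by rewrite expr_div_n !mulrA.
  apply: ler_piMl => //.
  apply: (le_trans (finite_coupling_le k l cP).1).
  by rewrite -m_sum (bigD1 k)//= lerDl sumr_ge0// => h _; exact: ltW.
(* 8 = 4 * 2: the constant of the domination hypothesis, times the two legs of the triangle
   inequality. *)
have PF (j : 'I_J) : \sum_k \sum_l (P k l)%:E * F j k l <=
    8%:E * \sum_k \sum_l (p j k l)%:E * distortion e (sc t j) (x k) (x l).
  have -> : 8%:E * \sum_k \sum_l (p j k l)%:E * distortion e (sc t j) (x k) (x l) =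
      2%:E * \sum_k \sum_l (p j k l)%:E * (4%:E * distortion e (sc t j) (x k) (x l)).
    have [pj0 _ _] := cp j.
    have D0 k l : 0 <= distortion e (sc t j) (x k) (x l) by exact: distortion_ge0.
    under [in RHS]eq_bigr => k _ do under eq_bigr => l _ do rewrite muleCA.
    under [in RHS]eq_bigr => k _.
      rewrite -ge0_sume_distrr; last by move=> l _; rewrite mule_ge0// lee_fin.
      over.
    rewrite -ge0_sume_distrr; last first.
      by move=> k _; apply: sume_ge0 => l _; rewrite mule_ge0// lee_fin.
    by rewrite muleA -EFinM -natrM.
  apply: posterior_cost => // [k l|k l h].
    by rewrite mule_ge0// distortion_ge0.
  rewrite /F /distortion -ge0_sume_distrr; last by move=> i _; exact: e0.
  rewrite -ge0_muleDr; last 2 first.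
  - by apply: sume_ge0 => i _; apply: e0; rewrite divr_ge0// ltW.
  - by apply: sume_ge0 => i _; apply: e0; rewrite divr_ge0// ltW.
  rewrite lee_wpmul2l// -big_split; apply: lee_sum => i _.
  exact: e_triangle.
have cost_le : \sum_k \sum_l (P k l)%:E * distortion d t (x k) (x l) <=
    \sum_(j < J) \sum_k \sum_l (P k l)%:E * F j k l + (K / t ^+ 2 / 2 ^+ J)%R%:E.
  apply: (@le_trans _ _ (\sum_(j < J) \sum_k \sum_l (P k l)%:E * F j k l +
     (\sum_k \sum_l P k l * T k l)%R%:E)); last by rewrite leeD2l// lee_fin.
  rewrite [X in _ <= X + _]exchange_big/= -sumEFin -big_split.
  apply: lee_sum => k _ /=.
  rewrite [X in _ <= X + _]exchange_big/= -sumEFin -big_split.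
  apply: lee_sum => l _ /=.
  rewrite -ge0_sume_distrr// EFinM -ge0_muleDr ?lee_fin//; last exact: sume_ge0.
  by rewrite lee_wpmul2l// lee_fin.
apply: (@le_trans _ _ (\sum_(j < J) (finite_information m (p j))%:E +
  (\sum_(j < J) 8%:E * \sum_k \sum_l (p j k l)%:E * distortion e (sc t j) (x k) (x l)
    + (K / t ^+ 2 / 2 ^+ J)%R%:E))).
  apply: leeD.
    rewrite sumEFin lee_fin; exact: posterior_information.
  apply: (le_trans cost_le); rewrite leeD2r//; exact: lee_sum.
rewrite addeA [leRHS]addeAC leeD2r// -big_split/=.
have -> : 8%:E * \sum_(j < J) rate_distortion e mu (sc t j) + eps%:E =
    \sum_(j < J) 8%:E * (rate_distortion e mu (sc t j) + (eps / (8 * J%:R))%:E).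
  under [RHS]eq_bigr => j _ do rewrite ge0_muleDr ?RD0 ?lee_fin ?(ltW eps'0)// -EFinM.
  rewrite big_split/= -ge0_sume_distrr//; congr (_ + _).
  rewrite sumEFin sumr_const card_ord -mulr_natr; congr (_%:E).
  by field; rewrite pnatr_eq0 -lt0n.
(* The information enters with coefficient 1, which is raised to 8 by nonnegativity to match the
   coefficient of the cost. *)
apply: lee_sum => j _; apply: (@le_trans _ _ (8%:E * ((finite_information m (p j))%:E +
   \sum_k \sum_l (p j k l)%:E * distortion e (sc t j) (x k) (x l)))).
  have I0 : (0 <= finite_information m (p j))%R by exact: finite_information_ge0.
  have [pj0 _ _] := cp j.
  rewrite ge0_muleDr//; last first.
    apply: sume_ge0 => k _; apply: sume_ge0 => l _.
    by rewrite mule_ge0// ?lee_fin// distortion_ge0.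
  by rewrite leeD2r// -EFinM lee_fin ler_peMl// ler1n.
by rewrite lee_wpmul2l.
Qed.

Lemma rate_distortion_series_le (t : R) : (0 < t)%R ->
  rate_distortion d mu t <= 8%:E * \sum_(0 <= j <oo) rate_distortion e mu (sc t j).
Proof.
move=> t0.
have s0 j : (0 < sc t j)%R by rewrite /sc divr_gt0// mulr_gt0// exprn_gt0.
apply/lee_addgt0Pr => eps eps0.
(* This choice gives K / (t^2 eps) < J <= 2^J, hence a remainder of at most [eps]. *)
pose J := (Num.truncn (K / t ^+ 2 / eps)).+1.
apply: (le_trans (rate_distortion_sum_le t0 (ltn0Sn _ : (0 < J)%N))).
apply: leeD.
  rewrite lee_wpmul2l// -(big_mkord predT (fun j => rate_distortion e mu (sc t j))).
  by apply: nneseries_lim_ge => j _ _; exact: rate_distortion_ge0.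
rewrite lee_fin ler_pdivrMr ?exprn_gt0// [leRHS]mulrC -ler_pdivrMr//.
apply: (@le_trans _ _ J%:R); first by apply: ltW; exact: truncnS_gt.
by rewrite -natrX ler_nat ltnW// ltn_expl.
Qed.

End pointwise.

(** * Monotone functions and dilations on the half-line *)

Section half_line.
Local Open Scope ereal_scope.
Context (R : realType).
Local Notation leb := (@lebesgue_measure R).
Local Notation halfline := `]0%R, +oo[%classic.

(** Preimages of upper rays are intervals. *)
Lemma nonincreasing_emeasurable (f : R -> \bar R) :
    (forall s t, (0 < s)%R -> (s <= t)%R -> f t <= f s) ->
  measurable_fun (halfline : set R) f.
Proof.
move=> fni mD; apply: (measurability (@ErealGenCInfty.G R)) => //.
  exact: ErealGenCInfty.measurableE.
move=> _ [_ [r ->] <-]; apply: is_interval_measurable => s t /=.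
rewrite !in_itv/= !andbT => -[s0 rs] [_ rt] u /andP[su ut].
have u0 := lt_le_trans s0 su.
by split; rewrite ?in_itv/= ?andbT//; rewrite (le_trans rt)// fni.
Qed.

(** Uniqueness of Lebesgue measure: c times its image under t -> c t gives half-open intervals their
    length. *)
Lemma lebesgue_measure_scale (c : R) (A : set R) : (0 < c)%R -> measurable A ->
  leb A = c%:E * leb [set t | A (c * t)%R].
Proof.
move=> c0 mA.
have mphi : measurable_fun [set: measurableTypeR R]
    (fun t => (c * t)%R : measurableTypeR R) by exact: mulrl_measurable.
pose phi (t : measurableTypeR R) : measurableTypeR R := (c * t)%R.
pose nu : {measure set (measurableTypeR R) -> \bar R} :=
  mscale (NngNum (ltW c0)) (pushforward leb phi).
transitivity (nu mphi A) => //; apply: lebesgue_measure_unique => // _ [[a b]] _ <-.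
rewrite -[RHS]/(c%:E * leb (phi @^-1` [set` `]a, b]%R])).
have -> : phi @^-1` [set` `]a, b]%R] = [set` `](a / c)%R, (b / c)%R]%R].
  apply/seteqP; split => t /=; rewrite !in_itv/= ltr_pdivrMr// ler_pdivlMr//.
    by rewrite !(mulrC t).
  by rewrite !(mulrC t).
rewrite !lebesgue_measure_itv/= !lte_fin ltr_pM2r ?invr_gt0//.
case: ifPn => _; last by rewrite mule0.
rewrite -!EFinD -EFinM; congr (_%:E); by field; rewrite gt_eqF.
Qed.

Lemma integral_scale (c : R) (f : R -> \bar R) : (0 < c)%R ->
    measurable_fun (halfline : set R) f -> (forall t, (0 < t)%R -> 0 <= f t) ->
  \int[leb]_(t in halfline) f (c * t)%R = c^-1%:E * \int[leb]_(t in halfline) f t.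
Proof.
move=> c0 mf f0.
have mphi : measurable_fun [set: measurableTypeR R]
    (fun t => (c * t)%R : measurableTypeR R) by exact: mulrl_measurable.
pose phi (t : measurableTypeR R) : measurableTypeR R := (c * t)%R.
pose nu : {measure set (measurableTypeR R) -> \bar R} :=
  mscale (NngNum (ltW c0)) (pushforward leb phi).
have f0' x : (halfline : set R) x -> 0 <= f x.
  by rewrite /= in_itv/= andbT; exact: f0.
have -> : \int[leb]_(t in halfline) f t = \int[nu mphi]_(t in halfline) f t.
  by apply: eq_measure_integral => A mA _; exact: lebesgue_measure_scale.
rewrite ge0_integral_mscale// ge0_integral_pushforward//.
  rewrite muleA -EFinM mulVf ?gt_eqF// mul1e; congr (integral _ _ _).
  by apply/seteqP; split => t /=; rewrite !in_itv/= !andbT pmulr_rgt0.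
by move=> y; rewrite inE; exact: f0'.
Qed.

End half_line.

(** Serves both for the sum over the scales 2^j t / 4 and for the integral of the error cost. *)
Lemma sum_half_geometric (R : realType) :
  (\sum_(0 <= j <oo) (2^-1 ^+ j)%:E = 2%:E :> \bar R)%E.
Proof.
apply/cvg_lim => //.
have -> : (fun n => \sum_(0 <= j < n) (2^-1 ^+ j)%:E)%E =
    EFin \o series (geometric (1 : R) 2^-1).
  apply/funext => n; rewrite sumEFin /series/=; congr (_%:E).
  by apply: eq_bigr => j _; rewrite mul1r.
have -> : 2%:E = (1 * (1 - 2^-1)^-1)%:E :> \bar R.
  by congr (_%:E); field.
apply: cvg_EFin; first exact: nearW.
apply: cvg_geometric_series.
by rewrite gtr0_norm ?invr_gt0// invf_lt1// ltr1n.
Qed.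

(** For a fixed coupling the information does not depend on the scale, and the distortion decreases
    as the scale grows. Measurability in t follows. *)
Lemma nonincreasing_rate_distortion (R : realType) n (d : 'I_n -> R -> \bar R)
    (mu : probability (n.-tuple R) R) (s t : R) :
    (forall i r, 0 <= r -> (0 <= d i r)%E) ->
    (forall i r r', 0 <= r -> r <= r' -> (d i r <= d i r')%E) ->
  0 < s -> s <= t -> (rate_distortion d mu t <= rate_distortion d mu s)%E.
Proof.
move=> d0 d_nd s0 st; have t0 := lt_le_trans s0 st.
apply: le_ereal_inf_tmp => _ [joint cj <-].
apply: (@le_trans _ _ (mutual_information joint +
   \int[joint]_z distortion d t z.1 z.2)%E).
  by apply: ereal_inf_lbound; exists joint.
rewrite leeD2l//; apply: ge0_le_integralT => z; first exact: distortion_ge0.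
apply: lee_sum => i _; apply: d_nd; first by apply: divr_ge0 => //; exact: ltW.
by rewrite ler_wpM2l// lef_pV2.
Qed.

(** * Integration over all scales *)

Section integrated.
Local Open Scope ereal_scope.
Context (R : realType) (n : nat) (mu : probability (n.-tuple R) R).
Hypothesis mu_fin : finitely_supported mu.
Context (d e : 'I_n -> R -> \bar R).
Hypotheses (d0 : forall i r, (0 <= r)%R -> 0 <= d i r)
  (e0 : forall i r, (0 <= r)%R -> 0 <= e i r)
  (d_nd : forall i r s, (0 <= r)%R -> (r <= s)%R -> d i r <= d i s)
  (e_nd : forall i r s, (0 <= r)%R -> (r <= s)%R -> e i r <= e i s)
  (de : forall i r J, (0 <= r)%R -> (0 < J)%N ->
    d i r <= 4%:E * \sum_(j < J) e i (2 * r / 2 ^+ j)%R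
             + (2 * r ^+ 2 / 2 ^+ J)%R%:E).

Lemma rate_distortion_integral_le :
  rate_distortion_integral d mu <= 64%:E * rate_distortion_integral e mu.
Proof.
have [I [x [x_inj mu_pos mu_supp]]] := finitely_supported_points mu_fin.
pose c j : R := (2 ^+ j / 4)%R.
have c0 j : (0 < c j)%R by rewrite divr_gt0// exprn_gt0.
have RDe0 t : (0 < t)%R -> 0 <= rate_distortion e mu t.
  by move=> t0; exact: (rate_distortion_ge0 x_inj mu_pos mu_supp).
have mRD (f : 'I_n -> R -> \bar R) : (forall i r, (0 <= r)%R -> 0 <= f i r) ->
   (forall i r s, (0 <= r)%R -> (r <= s)%R -> f i r <= f i s) ->
   measurable_fun (`]0%R, +oo[%classic : set R) (rate_distortion f mu).
  move=> f0 f_nd; apply: nonincreasing_emeasurable => s t s0 st.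
  exact: nonincreasing_rate_distortion.
have me j : measurable_fun (`]0%R, +oo[%classic : set R) (fun t => rate_distortion e mu (c j * t)%R).
  apply: nonincreasing_emeasurable => s t s0 st.
  by apply: nonincreasing_rate_distortion => //; rewrite ?mulr_gt0// ler_pM2l.
have pos (t : R) : (`]0%R, +oo[%classic : set R) t -> (0 < t)%R by rewrite /= in_itv/= andbT.
have e0' j t : (`]0%R, +oo[%classic : set R) t -> 0 <= rate_distortion e mu (c j * t)%R.
  by move=> /pos t0; rewrite RDe0// mulr_gt0.
rewrite /rate_distortion_integral.
apply: (@le_trans _ _ (\int[lebesgue_measure]_(t in `]0%R, +oo[)
   (8%:E * \sum_(0 <= j <oo) rate_distortion e mu (c j * t)%R))).
  apply: ge0_le_integral => //.
  - by move=> t /pos t0; exact: (rate_distortion_ge0 x_inj mu_pos mu_supp).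
  - exact: mRD.
  - apply: emeasurable_funM => //; apply: ge0_emeasurable_sum => //.
      by move=> j t tpos _; exact: e0'.
    by move=> j _; exact: me.
  move=> t /pos t0.
  apply: (le_trans (rate_distortion_series_le x_inj mu_pos mu_supp d0 e0 e_nd de t0)).
  rewrite lee_wpmul2l// le_eqVlt; apply/orP; left; apply/eqP.
  by apply: eq_eseriesr => j _; congr rate_distortion; rewrite /c; field.
rewrite ge0_integralZl//; last 2 first.
- apply: ge0_emeasurable_sum => [j t tpos _|j _]; [exact: e0'|exact: me].
- by move=> t tpos; apply: nneseries_ge0 => j _ _; exact: e0'.
rewrite integral_nneseries//.
under eq_eseriesr => j _.
  rewrite integral_scale//; last exact: mRD.
  (* The dilation factors add up to 8, whence 64 = 8 * 8. *)
  rewrite (_ : (c j)^-1 = 4 * 2^-1 ^+ j)%R; last first.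
    by rewrite /c invf_div exprVn.
  rewrite EFinM -muleA; over.
set A := integral _ _ _.
have A0 : 0 <= A by apply: integral_ge0 => t /pos; exact: RDe0.
(* An infinite integral is set apart, since only a real constant is taken out of the series
   below. *)
have [Aoo|Afin] := eqVneq A +oo; first by rewrite Aoo gt0_muley ?leey// lte_fin.
have {}Afin : A \is a fin_num by rewrite ge0_fin_numE// ltey.
rewrite -(fineK Afin).
under eq_eseriesr => j _ do
  rewrite [X in _ * X]muleC muleA -EFinM EFinM.
rewrite nneseriesZl; last by move=> j _; rewrite lee_fin exprn_ge0// invr_ge0.
rewrite sum_half_geometric -!EFinM lee_fin le_eqVlt; apply/orP; left; apply/eqP.
by ring.
Qed.

End integrated.

(** * Truncation of the error cost *)

Section error_cost.
Context (R : realType).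
Implicit Types (r s : R) (j J : nat).

Lemma chi_ge0 r : 0 <= chi r.
Proof. by rewrite /chi le_min ler01 sqr_ge0. Qed.

Lemma chi_le_sqr r : chi r <= r ^+ 2.
Proof. by rewrite /chi ge_min lexx orbT. Qed.

Lemma chi_small r : 0 <= r -> r <= 1 -> chi r = r ^+ 2.
Proof. by move=> r0 r1; rewrite /chi min_r// expr_le1. Qed.

Lemma chi_large r : 1 <= r -> chi r = 1.
Proof. by move=> r1; rewrite /chi min_l// expr_ge1// (le_trans ler01). Qed.

Lemma le_chi r s : 0 <= r -> r <= s -> chi r <= chi s.
Proof.
move=> r0 rs; rewrite /chi le_min !ge_min lexx/=; apply/orP; right.
by rewrite lerXn2r// nnegrE (le_trans r0).
Qed.

Lemma dyadic_slope_gt0 j : 0 < dyadic_slope R j.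
Proof. exact: exprn_gt0. Qed.

Lemma error_cost_ge0 r : (0 <= error_cost r)%E.
Proof. by apply: nneseries_ge0 => j _ _; rewrite lee_fin chi_ge0. Qed.

(** Beyond J, [chi] is bounded by the square, which leaves a geometric series of ratio 1/4. *)
Lemma error_cost_le_partial r J :
  (error_cost r <= \sum_(j < J) (chi (r / dyadic_slope R j))%:E + (r ^+ 2 / 2 ^+ J)%:E)%E.
Proof.
have chi0 j : (0 <= (chi (r / dyadic_slope R j))%:E)%E by rewrite lee_fin chi_ge0.
rewrite /error_cost (nneseries_split 0 J)// add0n big_mkord leeD2l//.
apply: lime_le; first by apply: is_cvg_nneseries => j _ _; exact: chi0.
near=> M.
have JM : (J <= M)%N by near: M; exact: nbhs_infty_ge.
(* A telescoping bound suited to induction on M: the new term 4^-(m+1) is at most 2^-m -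
   2^-(m+1). *)
apply: (@le_trans _ _ (r ^+ 2 * (2^-1 ^+ J - 2^-1 ^+ M))%:E); last first.
  by rewrite lee_fin -exprVn ler_wpM2l ?sqr_ge0// gerBl exprn_ge0.
rewrite sumEFin lee_fin -(subnKC JM); elim: (M - J)%N => [|k ih].
  by rewrite addn0 big_geq// subrr mulr0.
rewrite addnS big_nat_recr ?leq_addr//=.
apply: le_trans (lerD ih (chi_le_sqr _)) _.
rewrite /dyadic_slope expr_div_n -exprM -exprVn [(_ * 2)%N]mulnC exprM.
rewrite -mulrDr ler_wpM2l ?sqr_ge0//.
set m := (J + k)%N; set y : R := 2^-1.
rewrite [y ^+ m.+1]exprS.
have ym : 0 <= y ^+ m <= 1.
  by rewrite exprn_ge0 ?invr_ge0// exprn_ile1 ?invr_ge0// invf_le1// ler1n.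
have -> : (y ^+ 2) ^+ m.+1 = y ^+ 2 * (y ^+ m) ^+ 2.
  by rewrite exprS -!exprM mulnC.
have yE : y = 2^-1 by [].
rewrite yE; move: (y ^+ J) => w.
by move: (y ^+ m) ym => z /andP[z0 z1]; nra.
Unshelve. all: by end_near. Qed.

(** Since r / s_j = (r / 2^j) / 2, the j-th term of the error cost is at most e (r / 2^j), hence at
    most e (2 r / 2^j). The term e (2 r) is the summand j = 0, and 4 = 2 + 2. *)
Lemma dominated_cost (d e : R -> \bar R) :
    (forall r, 0 <= r -> ((chi (r / 2))%:E <= e r)%E) ->
    (forall r s, 0 <= r -> r <= s -> (e r <= e s)%E) ->
    (forall r, 0 <= r -> (d r <= 2%:E * e (2 * r)%R + 2%:E * error_cost r)%E) ->
  forall r J, 0 <= r -> (0 < J)%N ->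
    (d r <= 4%:E * \sum_(j < J) e (2 * r / 2 ^+ j)%R + (2 * r ^+ 2 / 2 ^+ J)%:E)%E.
Proof.
move=> e_chi e_nd de r J r0 J0; apply: (le_trans (de _ r0)).
have e0 s : 0 <= s -> (0 <= e s)%E.
  by move=> s0; rewrite (le_trans _ (e_chi _ s0))// lee_fin chi_ge0.
have h0 j : 0 <= 2 * r / 2 ^+ j by rewrite divr_ge0 ?mulr_ge0// exprn_ge0.
have S0 : (0 <= \sum_(j < J) e (2 * r / 2 ^+ j)%R)%E.
  by apply: sume_ge0 => j _; exact: e0.
apply: (@le_trans _ _ (2%:E * \sum_(j < J) e (2 * r / 2 ^+ j)%R +
    2%:E * (\sum_(j < J) e (2 * r / 2 ^+ j)%R + (r ^+ 2 / 2 ^+ J)%:E))%E).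
  apply: leeD; rewrite lee_wpmul2l//.
    case: J J0 h0 S0 => // J _ h0 S0; rewrite big_ord_recl/= expr0 divr1 leeDl//.
    by apply: sume_ge0 => j _; apply: e0; exact: h0.
  apply: (le_trans (error_cost_le_partial r J)); rewrite leeD2r//.
  apply: lee_sum => j _.
  have -> : r / dyadic_slope R j = (r / 2 ^+ j) / 2.
    by rewrite /dyadic_slope exprS invfM mulrA mulrAC.
  have rj : 0 <= r / 2 ^+ j by rewrite divr_ge0// exprn_ge0.
  apply: (le_trans (e_chi _ rj)); apply: e_nd => //.
  by rewrite ler_wpM2r ?invr_ge0 ?exprn_ge0// ler_peMl// ler1n.
rewrite ge0_muleDr//; last by rewrite lee_fin divr_ge0 ?sqr_ge0// exprn_ge0.
rewrite addeA -ge0_muleDl// -EFinD -EFinM mulrA.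
by have -> : 2 + 2 = 4 :> R by rewrite -natrD.
Qed.

End error_cost.

(** * The integral of the error cost *)

Section error_cost_integral.
Local Open Scope ereal_scope.
Context (R : realType).
Local Notation leb := (@lebesgue_measure R).

Lemma integral_inv_sqr_tail (s : R) : (0 < s)%R ->
  \int[leb]_(r in `]s, +oo[) (r ^- 2)%:E = (s^-1)%:E.
Proof.
move=> s0.
have pos x : (s <= x)%R -> (x != 0)%R by move=> sx; rewrite gt_eqF// (lt_le_trans s0).
have dF x : (s <= x)%R -> is_derive x 1%R (fun y : R => - y^-1)%R (x ^- 2)%R.
  move=> /pos x0; have := is_deriveN (is_deriveV x0 (is_derive_id x 1%R)).
  by rewrite scaler1 opprK.
have cF x : (s <= x)%R -> {for x, continuous (fun y : R => y ^- 2)%R}.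
  move=> /pos x0; apply: cvgV; first by rewrite expf_neq0.
  exact: exprn_continuous.
rewrite integral_itv_obnd_cbnd; last first.
  apply/measurable_EFinP.
  apply: open_continuous_measurable_fun => // x; rewrite inE/= in_itv/= andbT.
  by move=> /ltW; exact: cF.
rewrite (@ge0_continuous_FTC2y _ _ (fun y : R => - y^-1)%R _ 0%R).
- by rewrite -EFinB opprK add0r.
- by move=> x sx; rewrite invr_ge0 sqr_ge0.
- apply/continuous_within_itvcyP; split.
    by move=> x; rewrite in_itv/= andbT => /ltW; exact: cF.
  by apply: cvg_at_right_filter; exact: cF.
- rewrite -oppr0; apply: cvgN; apply/gtr0_cvgV0; last exact: cvg_id.
  exact: nbhs_pinfty_gt.
- by move=> x /ltW/dF[].
- by apply: cvg_at_right_filter; apply: cvgN; apply: cvgV; [exact: pos|exact: cvg_id].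
- move=> x; rewrite in_itv/= andbT derive1E => /ltW/dF h.
  by rewrite derive_val.
Qed.

Lemma measurable_chi_div (s : R) :
  measurable_fun (`]0%R, +oo[%classic : set R) (fun r => (chi (r / s) * r ^- 2)%:E).
Proof.
apply/measurable_EFinP; apply: measurable_funM.
  apply: measurable_funTS; apply: measurable_minr; first exact: measurable_cst.
  by apply: measurable_funX; exact: mulrr_measurable.
apply: open_continuous_measurable_fun => // x; rewrite inE/= in_itv/= andbT => x0.
apply: cvgV; first by rewrite expf_neq0// gt_eqF.
exact: exprn_continuous.
Qed.

(** The integrand is the constant s^-2 up to s and r^-2 beyond; each piece contributes 1 / s. *)
Lemma integral_chi (s : R) : (0 < s)%R ->
  \int[leb]_(r in `]0%R, +oo[) (chi (r / s) * r ^- 2)%:E = (2 / s)%:E.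
Proof.
move=> s0; have := measurable_chi_div s.
have -> : `]0%R, +oo[%classic = `]0%R, s]%classic `|` `]s, +oo[%classic :> set R.
  apply/seteqP; split => x /=; rewrite !in_itv/= !andbT.
    by move=> x0; have [xs|sx] := leP x s; [left; rewrite x0|right].
  by move=> [/andP[//]|]; exact: lt_trans.
move=> mg.
have E1 x : x \in (`]0%R, s]%classic : set R) -> (chi (x / s) * x ^- 2)%:E = (s ^- 2)%:E.
  rewrite inE/= in_itv/= => /andP[x0 xs].
  rewrite chi_small; last 2 first.
  - by rewrite divr_ge0// ltW.
  - by rewrite ler_pdivrMr// mul1r.
  by congr (_%:E); field; rewrite !gt_eqF.
have E2 x : x \in (`]s, +oo[%classic : set R) -> (chi (x / s) * x ^- 2)%:E = (x ^- 2)%:E.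
  rewrite inE/= in_itv/= andbT => sx.
  by rewrite chi_large ?mul1r// ler_pdivlMr// mul1r ltW.
rewrite ge0_integral_setU//; last 2 first.
- by move=> x _; rewrite lee_fin mulr_ge0 ?chi_ge0// invr_ge0 sqr_ge0.
- apply/disj_set2P/seteqP; split => // x /=; rewrite !in_itv/= andbT.
  by move=> [/andP[_ xs]]; rewrite ltNge xs.
transitivity ((s^-1)%:E + (s^-1)%:E).
  congr (_ + _); last first.
    by rewrite -integral_inv_sqr_tail//; apply: eq_integral => x; exact: E2.
  rewrite (eq_integral (cst (s ^- 2)%:E)); last by move=> x; exact: E1.
  rewrite integral_cst//= lebesgue_measure_itv/= lte_fin s0 -EFinB -EFinM.
  by congr (_%:E); field; rewrite gt_eqF.
by rewrite -EFinD; congr (_%:E); field; rewrite gt_eqF.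
Qed.

(** Series and integral are exchanged by nonnegativity, and 2 / s_j = 2^-j. *)
Lemma error_cost_integral :
  \int[leb]_(r in `]0%R, +oo[) (error_cost r * (r ^- 2)%:E) = 2%:E.
Proof.
transitivity (\int[leb]_(r in `]0%R, +oo[)
    \sum_(0 <= j <oo) (chi (r / dyadic_slope R j) * r ^- 2)%:E).
  apply: eq_integral => r _; rewrite muleC -nneseriesZl; last first.
    by move=> j _; rewrite lee_fin chi_ge0.
  by apply: eq_eseriesr => j _; rewrite -EFinM mulrC.
rewrite integral_nneseries//; last 2 first.
- by move=> j; exact: measurable_chi_div.
- by move=> j r _; rewrite lee_fin mulr_ge0 ?chi_ge0// invr_ge0 sqr_ge0.
rewrite -sum_half_geometric; apply: eq_eseriesr => j _.
rewrite integral_chi ?dyadic_slope_gt0// /dyadic_slope exprS invfM mulrA.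
by rewrite divff// mul1r exprVn.
Qed.

End error_cost_integral.

(** * The right derivative of the intrinsic potential *)

Section convex_tail.
Context (R : realType) (N : R -> \bar R).
Hypotheses (N_tail : closed_convex_tail N) (N_inv : tail_inverse N 1 = 1%E).
Local Notation b := (tail_bound N).

Let N_lsc : lower_semicontinuous N. Proof. by case: N_tail. Qed.

Let N_convex (u v t : R) : 0 <= u -> 0 <= v -> 0 <= t <= 1 ->
  (N (t * u + (1 - t) * v)%R <= t%:E * N u + (1 - t)%:E * N v)%E.
Proof. by case: N_tail => _ h _ _; exact: h. Qed.

Let N_nd u v : 0 <= u -> u <= v -> (N u <= N v)%E.
Proof. by case: N_tail => _ _ h _; exact: h. Qed.

Let N0 : N 0 = 0%E. Proof. by case: N_tail. Qed.

Let N_ge0 u : 0 <= u -> (0 <= N u)%E.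
Proof. by move=> u0; rewrite -N0 N_nd. Qed.

Lemma tail_boundE : b = ereal_sup (range (tail_inverse N)).
Proof.
apply/cvg_lim => //; apply: nondecreasing_cvge => p q pq.
apply: le_ereal_sup => _ [u [u0 Nu] <-]; exists u => //; split => //.
by rewrite (le_trans Nu)// lee_fin.
Qed.

Lemma tail_bound_ge1 : (1 <= b)%E.
Proof. by rewrite tail_boundE -N_inv; apply: ereal_sup_ubound; exists 1. Qed.

Lemma tail_fin_num u : 0 <= u -> (u%:E < b)%E -> N u \is a fin_num.
Proof.
move=> u0; rewrite tail_boundE => /ereal_sup_gt [_ [p _ <-]].
move=> /ereal_sup_gt [_ [v [v0 Nv] <-]]; rewrite lte_fin => uv.
rewrite ge0_fin_numE ?N_ge0//.
by rewrite (le_lt_trans (N_nd u0 (ltW uv)))// (le_lt_trans Nv)// ltry.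
Qed.

Lemma lt_tail_bound (s : R) : (s%:E < b)%E -> exists2 v, s < v & (v%:E < b)%E.
Proof.
case: b => [r| |]//; last by exists (s + 1); rewrite ?ltry// ltrDl.
by rewrite lte_fin => sr; exists ((s + r) / 2); rewrite ?lte_fin; lra.
Qed.

Let N_gt1 u : 1 < u -> (1 < N u)%E.
Proof.
move=> u1; rewrite ltNge; apply/negP => Nu.
have : (u%:E <= tail_inverse N 1)%E.
  by apply: ereal_sup_ubound; exists u => //; split => //; rewrite (le_trans _ (ltW u1)).
by rewrite N_inv lee_fin leNgt u1.
Qed.

Let f (u : R) : R := fine (N u).

(** If N 1 > 1, lower semicontinuity contradicts the points just below 1 with N <= 1. If N 1 < 1,
    convexity keeps N <= 1 slightly beyond 1, against the normalization. As 2 * 1 - 1 = 1^2, the two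
    branches of the potential agree at 1. *)
Lemma tail_at1 : (1 < b)%E -> f 1 = 1.
Proof.
move=> b1; have fin1 : N 1 \is a fin_num by rewrite tail_fin_num.
apply/le_anti/andP; split.
  rewrite -lee_fin fineK// leNgt; apply/negP => /N_lsc[V /nbhs_ballP[eps /= eps0 hV] VN].
  have : ((1 - eps)%:E < tail_inverse N 1)%E.
    by rewrite N_inv lte_fin ltrBlDr ltrDl.
  move=> /ereal_sup_gt[_ [u [u0 Nu] <-]]; rewrite lte_fin => ue.
  have u1 : u <= 1.
    by rewrite leNgt; apply/negP => /N_gt1; rewrite ltNge Nu.
  have : (1 < N u)%E by apply/VN/hV; rewrite /ball/= ger0_norm ?subr_ge0//; lra.
  by rewrite ltNge Nu.
have [v v1 vb] := lt_tail_bound b1.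
have v0 : 0 <= v by rewrite (le_trans _ (ltW v1)).
have finv := tail_fin_num v0 vb.
have fv1 : 1 < f v by rewrite -lte_fin fineK// N_gt1.
rewrite leNgt; apply/negP => f1.
(* The weight at which the chord from 1 to v has height 1. *)
pose t := (f v - 1) / (f v - f 1).
have d0 : 0 < f v - f 1 by lra.
have t1 : t < 1 by rewrite ltr_pdivrMr// mul1r; lra.
have t0 : 0 < t by rewrite divr_gt0//; lra.
have := N_convex ler01 v0 (t := t); rewrite (ltW t0) (ltW t1) => /(_ isT).
rewrite -(fineK fin1) -(fineK finv) -!EFinM -EFinD -/(f 1) -/(f v) leNgt.
have -> : t * f 1 + (1 - t) * f v = 1 by rewrite /t; field; rewrite gt_eqF.
by rewrite N_gt1//; nra.
Qed.

(* Monotonicity of the slopes of a convex function, with denominators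
   cleared. *)
Let three_point u w v : 0 <= u -> u < w -> w < v -> (v%:E < b)%E ->
  f w * (v - u) <= f u * (v - w) + f v * (w - u).
Proof.
move=> u0 uw wv vb.
have v0 : 0 <= v by lra.
have w0 : 0 <= w by lra.
have lt_b x : x < v -> (x%:E < b)%E by move=> xv; rewrite (lt_trans _ vb)// lte_fin.
have finu := tail_fin_num u0 (lt_b u (lt_trans uw wv)).
have finw := tail_fin_num w0 (lt_b w wv).
have finv := tail_fin_num v0 vb.
have d0 : 0 < v - u by lra.
pose t := (v - w) / (v - u).
have t01 : 0 <= t <= 1.
  by rewrite divr_ge0 ?ler_pdivrMr ?mul1r//=; lra.
have := N_convex u0 v0 t01.
have -> : t * u + (1 - t) * v = w by rewrite /t; field; rewrite gt_eqF.
rewrite -(fineK finu) -(fineK finv) -(fineK finw) -!EFinM -EFinD lee_fin.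
rewrite -/(f u) -/(f v) -/(f w) => h.
have := ler_wpM2r (ltW d0) h.
have -> // : (t * f u + (1 - t) * f v) * (v - u) = f u * (v - w) + f v * (w - u).
by rewrite /t; field; rewrite gt_eqF.
Qed.

Let potential s : 1 <= s -> (s%:E < b)%E ->
  fine (intrinsic_potential N s) = 2 * f s - 1.
Proof.
move=> s1 sb; have b1 : (1 < b)%E by rewrite (le_lt_trans _ sb)// lee_fin.
rewrite /intrinsic_potential b1 ger0_norm ?(le_trans ler01)//.
have [s1'|s1'] := leP s 1.
  have -> : s = 1 by apply/le_anti; rewrite s1 s1'.
  by rewrite tail_at1//= expr1n; lra.
have fins := tail_fin_num (le_trans ler01 s1) sb.
by rewrite (ltW sb) -(fineK fins).
Qed.

Let slope s h : R := (fine (intrinsic_potential N (s + h)) -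
  fine (intrinsic_potential N s)) / h.

Let slopeE s h : 1 <= s -> 0 < h -> ((s + h)%:E < b)%E ->
  slope s h = 2 * (f (s + h) - f s) / h.
Proof.
move=> s1 h0 sb; rewrite /slope !potential//.
- by congr (_ / _); ring.
- by rewrite (lt_trans _ sb)// lte_fin ltrDl.
- by rewrite (le_trans s1)// lerDl ltW.
Qed.

Let slope_nd s h k : 1 <= s -> 0 < h -> h <= k -> ((s + k)%:E < b)%E ->
  slope s h <= slope s k.
Proof.
move=> s1 h0; rewrite le_eqVlt => /predU1P[->//|hk] sb.
have k0 : 0 < k by lra.
rewrite !slopeE//; last by rewrite (lt_trans _ sb)// lte_fin ltrD2l.
rewrite ler_pdivrMr// mulrAC ler_pdivlMr//.
have := @three_point s (s + h) (s + k).
rewrite (le_trans ler01 s1) ltrDl h0 ltrD2l hk sb => /(_ isT isT isT isT).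
by nra.
Qed.

(** Convexity with f 0 = 0 and f 1 = 1 forces f s >= s for s >= 1. The chord from 0 to s then has
    slope at least 1, and so has every chord to the right of s; the potential doubles it. *)
Let slope_ge2 s h : 1 <= s -> 0 < h -> ((s + h)%:E < b)%E -> 2 <= slope s h.
Proof.
move=> s1 h0 sb.
have b1 : (1 < b)%E by rewrite (lt_trans _ sb)// lte_fin; lra.
have f1 := tail_at1 b1.
have f0 : f 0 = 0 by rewrite /f N0.
rewrite slopeE// ler_pdivlMr// ler_wpM2l// lerBrDr.
have fs : s <= f s.
  move: s1; rewrite le_eqVlt => /predU1P[<-|s1]; first by rewrite f1.
  have := @three_point 0 1 s; rewrite lexx ltr01 s1.
  rewrite (lt_trans _ sb) ?lte_fin ?ltrDl// => /(_ isT isT isT isT).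
  by rewrite f1 f0; lra.
have := @three_point 0 s (s + h).
rewrite lexx (lt_le_trans ltr01 s1) ltrDl h0 sb f0 => /(_ isT isT isT isT).
by nra.
Qed.

Lemma intrinsic_slope_small s : 0 < s < 1 -> intrinsic_slope N s = 2 * s.
Proof.
move=> /andP[s0 s1]; apply/cvg_lim; first exact: norm_hausdorff.
have V u : 0 <= u <= 1 -> fine (intrinsic_potential N u) = u ^+ 2.
  move=> /andP[u0 u1]; rewrite /intrinsic_potential ger0_norm// u1.
  by case: ifP.
rewrite -/(slope s).
have : (2 * s + h) @[h --> 0^'+] --> 2 * s.
  rewrite -[X in _ --> X]addr0; apply: cvgD; first exact: cvg_cst.
  by apply: cvg_at_right_filter; exact: cvg_id.
apply: cvg_trans; apply: near_eq_cvg; near=> h.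
have h0 : 0 < h by [].
have hs : h < 1 - s by near: h; apply: nbhs_right_lt; lra.
rewrite /slope !V; [|by lra|by lra].
by field; rewrite gt_eqF.
Unshelve. all: by end_near. Qed.

(** Difference quotients are nondecreasing in h and bounded below by 2, so the right limit exists
    and is their infimum. The point v keeps s + h in the region where N is finite. *)
Let slope_cvg s v : 1 <= s -> s < v -> (v%:E < b)%E ->
  intrinsic_slope N s = inf (slope s @` [set` `]0, v - s[]).
Proof.
move=> s1 sv vb; apply/cvg_lim; first exact: norm_hausdorff.
have lt_b h : h \in `]0, v - s[ -> ((s + h)%:E < b)%E.
  by rewrite in_itv/= => /andP[_ hv]; rewrite (lt_trans _ vb)// lte_fin; lra.
apply: (@nondecreasing_at_right_cvgr _ (slope s) 0 (BLeft (v - s))).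
- by rewrite bnd_simp subr_gt0.
- move=> h k hI kI hk; apply: slope_nd => //; last exact: lt_b.
  by move: hI; rewrite in_itv/= => /andP[].
- exists 2 => _ [h hI <-]; apply: slope_ge2 => //; last exact: lt_b.
  by move: hI; rewrite /= in_itv/= => /andP[].
Qed.

Lemma intrinsic_slope_ge2 s : 1 <= s -> (s%:E < b)%E -> 2 <= intrinsic_slope N s.
Proof.
move=> s1 /lt_tail_bound[v sv vb]; rewrite (slope_cvg s1 sv vb).
apply: lb_le_inf.
  exists (slope s ((v - s) / 2)), ((v - s) / 2) => //=.
  by rewrite in_itv/=; apply/andP; split; lra.
move=> _ [h hI <-]; move: hI; rewrite /= in_itv/= => /andP[h0 hv].
by apply: slope_ge2 => //; rewrite (lt_trans _ vb)// lte_fin; lra.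
Qed.

Lemma intrinsic_slope_nd s t : 1 <= s -> s <= t -> (t%:E < b)%E ->
  intrinsic_slope N s <= intrinsic_slope N t.
Proof.
move=> s1; rewrite le_eqVlt => /predU1P[->//|st] tb.
have [v tv vb] := lt_tail_bound tb.
have sv := lt_trans st tv; have t1 : 1 <= t by rewrite (le_trans s1)// ltW.
rewrite (slope_cvg s1 sv vb) (slope_cvg t1 tv vb).
apply: lb_le_inf.
  exists (slope t ((v - t) / 2)), ((v - t) / 2) => //=.
  by rewrite in_itv/=; apply/andP; split; lra.
move=> _ [h hI <-]; move: hI; rewrite /= in_itv/= => /andP[h0 hv].
have thb : ((t + h)%:E < b)%E by rewrite (lt_trans _ vb)// lte_fin; lra.
(* The chord from s to t separates the two derivatives: its slope is at least the infimum at s, and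
   at most any quotient at t. *)
apply: (@le_trans _ _ (slope s (t - s))).
  apply: ge_inf; last by exists (t - s) => //=; rewrite in_itv/=; apply/andP; split; lra.
  exists 2 => _ [k kI <-]; move: kI; rewrite /= in_itv/= => /andP[k0 kv].
  by apply: slope_ge2 => //; rewrite (lt_trans _ vb)// lte_fin; lra.
have st0 : 0 < t - s by lra.
have stE : s + (t - s) = t by rewrite addrC subrK.
rewrite !slopeE// ?stE// ler_pdivrMr// mulrAC ler_pdivlMr//.
have := @three_point s t (t + h).
rewrite (le_trans ler01 s1) st ltrDl h0 thb => /(_ isT isT isT isT).
by nra.
Qed.

End convex_tail.

(** * Comparison of the two costs, one dyadic slope level at a time *)

Section cost_comparison.
Local Open Scope ereal_scope.
Context (R : realType) (N : R -> \bar R).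
Hypotheses (N_tail : closed_convex_tail N) (N_inv : tail_inverse N 1 = 1).
Local Notation b := (tail_bound N).
Local Notation sigma := (intrinsic_slope N).
Local Notation sl := (dyadic_slope R).
Local Notation A := (slope_level N).
Local Notation w := (level_weight N).
Local Notation leb := (@lebesgue_measure R).

Let D : set R := [set s | (0 < s)%R /\ s%:E < b].

Let b1 : 1 <= b. Proof. exact: tail_bound_ge1. Qed.

Let sigma_small s : (0 < s < 1)%R -> sigma s = (2 * s)%R.
Proof. exact: intrinsic_slope_small. Qed.

Let sigma_ge2 s : (1 <= s)%R -> s%:E < b -> (2 <= sigma s)%R.
Proof. exact: intrinsic_slope_ge2. Qed.

Let sigma_ge0 s : D s -> (0 <= sigma s)%R.
Proof.
move=> [s0 sb]; have [s1|s1] := ltP s 1%R.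
  by rewrite sigma_small ?s0// mulr_ge0// ltW.
by rewrite (le_trans _ (sigma_ge2 s1 sb)).
Qed.

Let sigma_nd s t : D s -> D t -> (s <= t)%R -> (sigma s <= sigma t)%R.
Proof.
move=> [s0 sb] [t0 tb] st; have [t1|t1] := ltP t 1%R.
  by rewrite !sigma_small ?s0 ?t0//= ?(le_lt_trans st)// ler_wpM2l.
have [s1|s1] := ltP s 1%R; last exact: intrinsic_slope_nd.
rewrite sigma_small ?s0//; apply: le_trans (sigma_ge2 t1 tb).
by lra.
Qed.

Let D_itv (s t u : R) : D s -> D t -> (s <= u <= t)%R -> D u.
Proof.
move=> [s0 sb] [t0 tb] /andP[su ut]; split; first exact: lt_le_trans su.
by rewrite (le_lt_trans _ tb)// lee_fin.
Qed.

Let mD : measurable D.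
Proof. by apply: is_interval_measurable => s t sD tD u; exact: D_itv. Qed.

Let m_sigma : measurable_fun D sigma.
Proof.
move=> _; apply: (measurability (@RGenCInfty.G R)) => //.
  exact: RGenCInfty.measurableE.
move=> _ [_ [r ->] <-].
apply: is_interval_measurable => s t /= [sD rs] [tD rt] u sut.
have uD := D_itv sD tD sut; split => //.
move: rs; rewrite !in_itv/= !andbT => rs; rewrite (le_trans rs)//.
by apply: sigma_nd => //; case/andP: sut.
Qed.

Let g r s : \bar R := (sigma s * \1_[set s | (sigma s < r)%R] s)%:E.

Let gE r s : g r s = if (sigma s < r)%R then (sigma s)%:E else 0.
Proof.
rewrite /g indicE; case: ifPn => sr; first by rewrite mem_set// mulr1.
by rewrite memNset ?mulr0//=; exact/negP.
Qed.

Let mg r : measurable_fun D (g r).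
Proof.
apply/measurable_EFinP.
have -> : (fun s => sigma s * \1_[set s | (sigma s < r)%R] s)%R =
    (fun y : R => y * \1_(`]-oo, r[%classic : set R) y)%R \o sigma.
  by apply/funext => s /=; congr (_ * _)%R; rewrite !indicE.
apply: measurableT_comp => //; apply: measurable_funM => //.
Qed.

Let g_ge0 r s : D s -> 0 <= g r s.
Proof. by move=> sD; rewrite gE; case: ifP => // _; rewrite lee_fin sigma_ge0. Qed.

Let A_D j : A j `<=` D.
Proof. by move=> u [u1 ub _ _]; split => //; exact: lt_le_trans u1. Qed.

Let mA j : measurable (A j).
Proof.
apply: is_interval_measurable => s t sA tA u sut.
have [sD tD] := (A_D sA, A_D tA); have uD := D_itv sD tD sut.
case: sA tA => [s1 _ sls _] [_ _ _ slt]; case/andP: sut => su ut; split.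
- exact: le_trans su.
- by case: uD.
- by rewrite (le_trans sls)// sigma_nd.
- by rewrite (le_lt_trans _ slt)// sigma_nd.
Qed.

Let A_triv : trivIset setT A.
Proof.
apply: ltn_trivIset => j i ij; apply/seteqP; split => // u [].
move=> [_ _ _ ui] [_ _ uj _]; have := le_lt_trans uj ui.
rewrite /dyadic_slope -exprS ltr_eXn2l ?ltr1n// ltnS => /leq_trans/(_ ij).
by rewrite ltnn.
Qed.

Let A_cover : \bigcup_j A j = [set s | (1 <= s)%R /\ s%:E < b].
Proof.
apply/seteqP; split => [u [j _ [u1 ub _ _]]//|u [u1 ub]].
have s2 := sigma_ge2 u1 ub.
(* The level is the binary logarithm of the integer part of the slope, shifted by one because s_j =
   2^(j+1). The slope is at least 2, so the logarithm is positive and the shift is legitimate. *)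
pose k := Num.truncn (sigma u).
have k2 : (2 <= k)%N by rewrite truncn_ge_nat// (le_trans _ s2).
have ks : (k%:R <= sigma u)%R by rewrite truncn_le (le_trans _ s2).
have sk : (sigma u < k.+1%:R)%R by exact: truncnS_gt.
have := @trunc_log_bounds 2 k isT (ltnW k2).
set p := trunc_log 2 k => /andP[pk kp].
have p1 : (0 < p)%N by rewrite trunc_log_gt0.
exists p.-1 => //; split => //.
  by rewrite /dyadic_slope prednK// -natrX (le_trans _ ks)// ler_nat.
by rewrite /dyadic_slope prednK// -exprS -natrX (lt_le_trans sk)// ler_nat.
Qed.

Let D_split : D = `]0%R, 1%R[%classic `|` \bigcup_j A j.
Proof.
rewrite A_cover; apply/seteqP; split => [s [s0 sb]|s [|[s1 sb]]].
- by have [s1|s1] := ltP s 1%R; [left; rewrite /= in_itv/= s0|right].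
- rewrite /= in_itv/= => /andP[s0 s1]; split => //.
  by rewrite (lt_le_trans _ b1)// lte_fin.
- by split => //; exact: lt_le_trans s1.
Qed.

Let T r j : \bar R := \int[leb]_(s in A j) g r s.

Let T_ge0 r j : 0 <= T r j.
Proof. by apply: integral_ge0 => s /A_D; exact: g_ge0. Qed.

Let wE j : w j = (sl j)%:E * leb (A j). Proof. by []. Qed.

Let w_ge0 j : 0 <= w j.
Proof. by rewrite mule_ge0// lee_fin ltW// dyadic_slope_gt0. Qed.

Let T_le r j : T r j <= 2%:E * w j.
Proof.
rewrite wE muleA -EFinM -(integral_cst leb (mA j)); apply: ge0_le_integral => //.
- exact: mA.
- by move=> s /A_D; exact: g_ge0.
- exact: measurable_funS (@A_D j) (mg r).
- move=> s [_ _ _ sls]; rewrite gE; case: ifP => _; first by rewrite lee_fin ltW.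
  by rewrite lee_fin mulr_ge0// ltW// dyadic_slope_gt0.
Qed.

Let T_eq0 r j : (r <= sl j)%R -> T r j = 0.
Proof.
move=> rs; apply: integral0_eq => s [_ _ sls _].
by rewrite gE ltNge (le_trans rs sls).
Qed.

Let T_ge r j : (2 * sl j <= r)%R -> w j <= T r j.
Proof.
move=> rs; rewrite wE -(integral_cst leb (mA j)); apply: ge0_le_integral => //.
- exact: mA.
- by move=> s _; rewrite lee_fin ltW// dyadic_slope_gt0.
- exact: measurable_funS (@A_D j) (mg r).
- by move=> s [_ _ h1 h2]; rewrite gE (lt_le_trans h2 rs) lee_fin.
Qed.

Let integral_double (c : R) : (0 <= c)%R ->
  \int[leb]_(s in `]0%R, c[) (2 * s)%:E = (c ^+ 2)%:E.
Proof.
rewrite le_eqVlt => /predU1P[<-|c0].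
  by rewrite set_itvoo0 integral_set0 expr0n.
rewrite -(@integral_itv_bndoo _ 0%R c _ true false); last first.
  by apply/measurable_EFinP; exact: mulrl_measurable.
have dF (x : R) : is_derive x (1%R : R) (fun y : R => y ^+ 2)%R (2 * x)%R.
  have := is_deriveX 2 (is_derive_id x (1%R : R)).
  by rewrite /GRing.scale/= mulr1.
rewrite (@continuous_FTC2 _ _ (fun y : R => y ^+ 2)%R)//.
- by rewrite expr0n/= sube0.
- apply: continuous_subspaceT; exact: mulrl_continuous.
- split.
  + by move=> x _; case: (dF x).
  + by apply: cvg_at_right_filter; exact: exprn_continuous.
  + by apply: cvg_at_left_filter; exact: exprn_continuous.
- by move=> x _; rewrite derive1E derive_val.
Qed.

Let integral_small r : (0 <= r)%R ->
  \int[leb]_(s in `]0%R, 1%R[) g r s = (chi (r / 2))%:E.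
Proof.
(* The cutoff 2 s < r restricts the unit interval to ]0, c[, where the primitive s^2 gives c^2. *)
move=> r0; pose c := Num.min 1%R (r / 2)%R.
have c0 : (0 <= c)%R by rewrite le_min ler01 divr_ge0.
have c1 : (c <= 1)%R by rewrite ge_min lexx.
have -> : chi (r / 2) = (c ^+ 2)%R.
  have r20 : (0 <= r / 2)%R by rewrite divr_ge0.
  rewrite /c; case: leP => h; first by rewrite expr1n chi_large.
  by rewrite chi_small// ltW.
have gsmall s : (0 < s < 1)%R -> g r s = if (s < c)%R then (2 * s)%:E else 0.
  move=> s01; rewrite gE sigma_small// /c lt_min; case/andP: s01 => _ ->.
  by rewrite ltr_pdivlMr// (mulrC s).
rewrite -integral_double//.
rewrite [LHS]integral_mkcond [RHS]integral_mkcond; apply: eq_integral => s _.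
rewrite !patchE !mem_setE !in_itv/=.
case: (ltP 0%R s) => //= s0; have [s1|s1] := ltP s 1%R.
  by rewrite gsmall ?s0.
by rewrite ltNge (le_trans c1 s1).
Qed.

Lemma intrinsic_cost_split r : (0 <= r)%R ->
  intrinsic_cost N r = (chi (r / 2))%:E + \sum_(0 <= j <oo) T r j.
Proof.
move=> r0; rewrite /intrinsic_cost -/D.
have mgr := mg r.
transitivity (\int[leb]_(s in D) g r s) => //.
have mU : measurable (\bigcup_j A j) by exact: bigcup_measurable.
have gU s : (\bigcup_j A j) s -> 0 <= g r s by move=> [j _ /A_D]; exact: g_ge0.
have UD : \bigcup_j A j `<=` D by move=> s [j _ /A_D].
rewrite {1}D_split ge0_integral_setU//; last 3 first.
- by rewrite -D_split.
- by rewrite -D_split; exact: g_ge0.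
- apply/disj_set2P/seteqP; split => // s [/=]; rewrite A_cover in_itv/= => /andP[_ s1].
  by move=> [/(lt_le_trans s1)]; rewrite ltxx.
rewrite integral_small// ge0_integral_bigcup//.
exact: measurable_funS UD mgr.
Qed.

(** The summand padded by 0 on light levels, so that both costs become series over all j and can be
    compared termwise. *)
Let phi r j : \bar R :=
  if 1 <= w j then psi (level_beta N j) (dyadic_step R j * r)%R else 0.

Lemma expansion_costE r :
  expansion_cost N r = (chi (r / 2))%:E + \sum_(0 <= j <oo) phi r j.
Proof. by rewrite /expansion_cost eseries_mkcond. Qed.

Let phi_small r j : (r <= sl j)%R ->
  phi r j = if 1 <= w j then ((r / sl j) ^+ 2)%:E else 0.
Proof.
move=> rs; rewrite /phi; case: ifP => // _; have s0 := dyadic_slope_gt0 R j.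
rewrite /psi /dyadic_step ifT; last by rewrite mulrAC ler_pdivrMr// ler_wpM2l.
by congr (_%:E); field; rewrite gt_eqF.
Qed.

Let phi_large r j : (sl j < r)%R -> phi r j = if 1 <= w j then w j else 0.
Proof.
move=> rs; rewrite /phi; case: ifP => // w1; have s0 := dyadic_slope_gt0 R j.
rewrite /psi /dyadic_step ifF; last first.
  by apply/negbTE; rewrite -ltNge mulrAC ltr_pdivlMr// ltr_pM2l.
(* The parameter beta = (w + 1) / 2 is made so that 2 beta - 1 = w, including when w = +oo. *)
rewrite /level_beta muleC -muleA -EFinM mulVf// mule1.
by rewrite addeK.
Qed.

Let phi_ge0 r j : 0 <= phi r j.
Proof.
have [rs|rs] := leP r (sl j); [rewrite phi_small//|rewrite phi_large//];
  by case: ifP => // _; rewrite ?lee_fin ?sqr_ge0 ?w_ge0.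
Qed.

Let phi_nd r r' j : (0 <= r)%R -> (r <= r')%R -> phi r j <= phi r' j.
Proof.
move=> r0 rr'; have s0 := dyadic_slope_gt0 R j.
have [r's|r's] := leP r' (sl j).
  have rs := le_trans rr' r's.
  rewrite !phi_small//; case: ifP => // _; rewrite lee_fin.
  have h0 x : (0 <= x)%R -> (0 <= x / sl j)%R by move=> x0; rewrite divr_ge0// ltW.
  rewrite lerXn2r ?nnegrE//; [exact: h0|exact/h0/(le_trans r0)|].
  by rewrite ler_pM2r ?invr_gt0.
rewrite (phi_large r's); have [rs|rs] := leP r (sl j); last by rewrite phi_large.
(* Across the threshold s_j the summand jumps upwards: the quadratic branch is at most 1, and w_j >=
   1. *)
rewrite phi_small//; case: ifP => // w1; apply: le_trans w1.
rewrite lee_fin expr_le1//; last by rewrite divr_ge0// ltW.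
by rewrite ler_pdivrMr ?mul1r.
Qed.

Lemma expansion_cost_ge_chi r : (chi (r / 2))%:E <= expansion_cost N r.
Proof. by rewrite expansion_costE leeDl// nneseries_ge0. Qed.

Lemma expansion_cost_nd r r' : (0 <= r)%R -> (r <= r')%R ->
  expansion_cost N r <= expansion_cost N r'.
Proof.
move=> r0 rr'; rewrite !expansion_costE leeD//.
  by rewrite lee_fin; apply: le_chi; [exact: divr_ge0|rewrite ler_pM2r].
by apply: lee_nneseries => // j _; exact: phi_nd.
Qed.

Lemma intrinsic_cost_ge_chi r : (0 <= r)%R ->
  (chi (r / 2))%:E <= intrinsic_cost N r.
Proof. by move=> r0; rewrite intrinsic_cost_split// leeDl// nneseries_ge0. Qed.

Lemma intrinsic_cost_nd r r' : (r <= r')%R ->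
  intrinsic_cost N r <= intrinsic_cost N r'.
Proof.
move=> rr'; apply: ge0_le_integral => //.
- by move=> s sD; exact: g_ge0.
- exact: mg.
- exact: mg.
- move=> s sD; rewrite -!/(g _ s) !gE; case: ifPn => [sr|_].
    by rewrite (lt_le_trans sr rr').
  by case: ifP => // _; rewrite lee_fin sigma_ge0.
Qed.

Lemma intrinsic_cost_le r : (0 <= r)%R ->
  intrinsic_cost N r <= 2%:E * expansion_cost N r + 2%:E * error_cost r.
Proof.
move=> r0; rewrite intrinsic_cost_split// expansion_costE.
have chi0 s : 0 <= (chi s)%:E by rewrite lee_fin chi_ge0.
have S0 : 0 <= \sum_(0 <= j <oo) phi r j by exact: nneseries_ge0.
rewrite ge0_muleDr; [|exact: chi0|exact: S0].
rewrite -addeA leeD//.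
  by rewrite -EFinM lee_fin ler_peMl ?chi_ge0// ler1n.
rewrite -!nneseriesZl// -nneseriesD//; last 2 first.
- by move=> j _ _; rewrite mule_ge0.
- by move=> j _ _; rewrite mule_ge0.
apply: lee_nneseries => // j _; have s0 := dyadic_slope_gt0 R j.
have [rs|rs] := leP r (sl j).
  by rewrite T_eq0// adde_ge0// mule_ge0.
rewrite phi_large// chi_large; last by rewrite ler_pdivlMr// mul1r ltW.
apply: (le_trans (T_le r j)); case: ifPn => w1; first by rewrite leeDl// mule_ge0.
(* On a light level w_j < 1, so 2 w_j is paid by the error term, equal to 2 for r > s_j. *)
rewrite mule0 add0e lee_wpmul2l// ltW//.
by rewrite ltNge.
Qed.

(** The expansion term jumps to w_j just past s_j, while the intrinsic term is sure to reach w_j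
    only from 2 s_j on: this explains the halved argument. Before the jump, the quadratic branch is
    at most the j-th error term. *)
Lemma expansion_cost_half_le r : (0 <= r)%R ->
  expansion_cost N (r / 2)%R <= intrinsic_cost N r + error_cost (r / 2)%R.
Proof.
move=> r0; rewrite intrinsic_cost_split// expansion_costE -addeA leeD//.
  rewrite lee_fin; apply: le_chi; first by rewrite !divr_ge0.
  by rewrite ler_pM2r// ler_piMr// invf_le1// ler1n.
have chi0 s : 0 <= (chi s)%:E by rewrite lee_fin chi_ge0.
rewrite -nneseriesD//; apply: lee_nneseries => // j _.
have s0 := dyadic_slope_gt0 R j.
have [rs|rs] := leP (r / 2)%R (sl j).
  rewrite phi_small//; case: ifP => _; last by rewrite adde_ge0.
  rewrite chi_small ?leeDr//; first by rewrite divr_ge0 ?divr_ge0// ltW.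
  by rewrite ler_pdivrMr// mul1r.
rewrite phi_large//; case: ifP => _; last by rewrite adde_ge0.
apply: (@le_trans _ _ (T r j)); last by rewrite leeDl//; exact: chi0.
by apply: T_ge; rewrite mulrC -ler_pdivlMr// ltW.
Qed.

End cost_comparison.

(** * The comparison theorem *)

Local Open Scope ereal_scope.

Theorem proposition7p1 (R : realType) :
  exists C : R, (1 <= C)%R /\
  forall (n : nat) (disp : measure_display) (Omega : measurableType disp)
    (P : probability Omega R) (Y : 'I_n -> {RV P >-> R}),
    let N := fun i => log_tail (Y i) in
    mutually_independent Y ->
    (forall i, symmetric_rv (Y i)) ->
    (forall i, nonzero_rv (Y i)) ->
    (forall i, closed_convex_tail (N i)) ->
    (forall i, tail_inverse (N i) 1 = 1) ->
    let Psi := fun i => intrinsic_cost (N i) in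
    let Phi := fun i => expansion_cost (N i) in
    [/\ forall (i : 'I_n) (r : R), (0 <= r)%R ->
          Psi i r <= 2%:E * Phi i r + 2%:E * error_cost r,
        forall (i : 'I_n) (r : R), (0 <= r)%R ->
          Phi i (r / 2)%R <= Psi i r + error_cost (r / 2)%R,
        \int[lebesgue_measure]_(r in `]0%R, +oo[)
          (error_cost r * (r ^- 2)%:E) = 2%:E :> \bar R &
        forall mu : probability (n.-tuple R) R, finitely_supported mu ->
          C^-1%:E * rate_distortion_integral Phi mu
            <= rate_distortion_integral Psi mu /\
          rate_distortion_integral Psi mu
            <= C%:E * rate_distortion_integral Phi mu].
Proof.
exists 64%R; split; first by rewrite ler1n.
move=> n disp Omega P Y N _ _ _ N_tail N_inv Psi Phi.
have Psi_chi i r : (0 <= r)%R -> (chi (r / 2))%:E <= Psi i r.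
  exact: intrinsic_cost_ge_chi.
have Phi_chi i r : (0 <= r)%R -> (chi (r / 2))%:E <= Phi i r.
  by move=> _; exact: expansion_cost_ge_chi.
have Psi_nd i r s : (0 <= r)%R -> (r <= s)%R -> Psi i r <= Psi i s.
  by move=> _; exact: intrinsic_cost_nd.
have Phi_nd i r s : (0 <= r)%R -> (r <= s)%R -> Phi i r <= Phi i s.
  exact: expansion_cost_nd.
have ge0 (e : 'I_n -> R -> \bar R) :
    (forall i r, (0 <= r)%R -> (chi (r / 2))%:E <= e i r) ->
    forall i r, (0 <= r)%R -> 0 <= e i r.
  by move=> e_chi i r r0; rewrite (le_trans _ (e_chi i r r0))// lee_fin chi_ge0.
have Psi_Phi i r : (0 <= r)%R -> Psi i r <= 2%:E * Phi i r + 2%:E * error_cost r.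
  exact: intrinsic_cost_le.
have Phi_Psi i r : (0 <= r)%R -> Phi i (r / 2)%R <= Psi i r + error_cost (r / 2)%R.
  exact: expansion_cost_half_le.
split => //; first exact: error_cost_integral.
move=> mu mu_fin; split.
  rewrite muleC lee_pdivrMr// muleC.
  apply: rate_distortion_integral_le => //; [exact: ge0|exact: ge0|].
  move=> i; apply: dominated_cost => [||r r0]; [exact: Psi_chi|exact: Psi_nd|].
  have r2 : (0 <= 2 * r)%R by rewrite mulr_ge0.
  (* The half-argument inequality is taken at 2 r; its coefficients 1 are then weakened to the 2
     that [dominated_cost] expects. *)
  have := Phi_Psi i _ r2; rewrite mulrAC divff// mul1r => /le_trans; apply.
  by apply: leeD; rewrite lee_pemull ?error_cost_ge0 ?(ge0 _ Psi_chi) ?lee1n.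
apply: rate_distortion_integral_le => //; [exact: ge0|exact: ge0|].
move=> i; apply: dominated_cost => [||r r0]; [exact: Phi_chi|exact: Phi_nd|].
(* Here the argument r is enlarged to 2 r by monotonicity. *)
apply: (le_trans (Psi_Phi i r r0)); rewrite leeD2r// lee_wpmul2l//.
by apply: Phi_nd => //; rewrite ler_peMl// ler1n.
Qed.
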